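(* Let $\mu>0$, $\lambda\ge0$ be constants, $Q(G)=2\mu|\mathrm{sym}\,G|^2+\lambda(\mathrm{trace}\,G)^2$, let $S=\{\bar x\in\mathbb R^2:|\bar x|<1\}$, $\omega=(0,\ell)$ and $\gamma\in\{0,\infty\}$. Then for every $K\in L^2(\omega;\mathrm{Skew}(3))$ satisfying $|Ke_1|\le1$ a.e. in $\omega$, there exist measurable functions $\alpha:\omega\to[0,2\pi)$ and $\theta:\omega\to[0,1]$ such that the spontaneous curvature--torsion tensor $K_{\rm eff}$ (defined in the context) associated with the prestrain $$B(x_1,\bar x,y):=\frac{3\pi}8\,\mathbf 1_{Z_{\theta(x_1),\alpha(x_1)}}(\bar x,y)\,\mathrm{Id}$$ satisfies $(K-K_{\rm eff})e_1=0$ a.e. in $\omega$.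
   Context: Notation. $e_1,e_2,e_3$ is the standard basis of $\mathbb R^3$; $\bar x=(x_2,x_3)$; $\bar{\boldsymbol x}:=x_2e_2+x_3e_3\in\mathbb R^3$; $(a\otimes b)c=(b\cdot c)a$; $\mathrm{Sym}(3)$, $\mathrm{Skew}(3)$: symmetric, skew-symmetric $3\times3$ matrices; $Y=[0,1)$, $\mathcal Y=\mathbb R/\mathbb Z$; $\bar\nabla=(\partial_2,\partial_3)$; $(v\,|\,N)$ is the $3\times3$ matrix with first column $v$ and last two columns $N\in\mathbb R^{3\times2}$. For $\theta\in[0,1]$ and $\alpha\in[0,2\pi)$, $$Z_{\theta,\alpha}=\big\{(\bar x,y)\in S\times Y:\ y\in[0,\theta),\ \bar x=r(\cos\varphi,\sin\varphi)\text{ with }r\in[0,1],\ \varphi\in[\alpha-\tfrac\pi2,\alpha+\tfrac\pi2)\big\}.$$ On $\boldsymbol H=L^2(S\times\mathcal Y;\mathrm{Sym}(3))$ use the scalar product $(F,G)=\iint_{S\times Y}\langle\mathbb LF,G\rangle\,dy\,d\bar x$, where $\langle\mathbb LF,G\rangle=\frac12(Q(F+G)-Q(F)-Q(G))$. For $(K,a)\in\mathrm{Skew}(3)\times\mathbb R$ let $\mathbf E(K,a)=\mathrm{sym}[(K\bar{\boldsymbol x}+ae_1)\otimes e_1]$, viewed as an element of $\boldsymbol H$ (constant in $y$). $\boldsymbol H^\gamma_{\rm rel}\subset\boldsymbol H$ is: for $\gamma=0$, all $\mathrm{sym}[((\partial_y\Psi)\bar{\boldsymbol x}+\partial_y\hat\phi\,|\,\bar\nabla\bar\phi)]$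 with $\Psi\in H^1(\mathcal Y;\mathrm{Skew}(3))$, $\hat\phi\in H^1(\mathcal Y;\mathbb R^3)$, $\bar\phi\in L^2(\mathcal Y;H^1(S;\mathbb R^3))$; for $\gamma=\infty$, all $\mathrm{sym}[(\partial_y\hat\phi\,|\,\bar\nabla\bar\phi)]$ with $\hat\phi\in L^2(S;H^1(\mathcal Y;\mathbb R^3))$, $\bar\phi\in H^1(S;\mathbb R^3)$. Let $\boldsymbol H^\gamma=\{\mathbf E(K,a)+\chi:(K,a)\in\mathrm{Skew}(3)\times\mathbb R,\ \chi\in\boldsymbol H^\gamma_{\rm rel}\}$ and let $P^\gamma_{\rm rel}$ be the $(\cdot,\cdot)$-orthogonal projection of $\boldsymbol H$ onto the orthogonal complement of $\boldsymbol H^\gamma_{\rm rel}$ in $\boldsymbol H^\gamma$. For $B\in L^2(\omega\times S\times\mathcal Y;\mathbb R^{3\times3})$, $(K_{\rm eff},a_{\rm eff})\in L^2(\omega;\mathrm{Skew}(3)\times\mathbb R)$ is the unique field with $P^\gamma_{\rm rel}\mathbf E(K_{\rm eff}(x_1),a_{\rm eff}(x_1))=P^\gamma_{\rm rel}\,\mathrm{sym}\,B(x_1,\cdot)$ for a.e. $x_1\in\omega$ (the map $(K,a)\mapsto P^\gamma_{\rm rel}\mathbf E(K,a)$ is a linear isomorphism onto the orthogonal complement of $\boldsymbol H^\gamma_{\rm rel}$ in $\boldsymbol H^\gamma$). *)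

(* Defs.v *)
From HB Require Import structures.
From mathcomp Require Import all_boot all_order all_algebra.
From mathcomp Require Import all_classical all_reals all_analysis.

Set Implicit Arguments.
Unset Strict Implicit.
Unset Printing Implicit Defensive.

Import Order.TTheory GRing.Theory Num.Theory.
Import numFieldNormedType.Exports.
Local Open Scope classical_set_scope.
Local Open Scope ring_scope.

(* A cross-sectional point (x_2, x_3) is a pair x : R * R, and a point of
   S x Y is z = (x, y) : (R * R) * R. The coordinates 1, 2, 3 of R^3 are the
   ordinals 0, 1, 2 of 'I_3. Elements of L^2 spaces are represented by
   measurable functions; they are only relevant up to a.e. equality. *)

Definition e_ {R : realType} (i : 'I_3) : 'cV[R]_3 := delta_mx i 0.

(* Euclidean (Frobenius) norm: the library norm `|A| on matrices is the sup
   norm. *)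
Definition fnorm {R : realType} (m n : nat) (A : 'M[R]_(m, n)) : R :=
  Num.sqrt (\sum_i \sum_j A i j ^+ 2).

Definition sym {R : realType} (A : 'M[R]_3) : 'M[R]_3 := 2^-1 *: (A + A^T).

Definition symmetric3 {R : realType} (A : 'M[R]_3) : Prop := A^T = A.

Definition skew3 {R : realType} (A : 'M[R]_3) : Prop := A^T = - A.

Definition tensor {R : realType} (a b : 'cV[R]_3) : 'M[R]_3 := a *m b^T.

Definition xbold {R : realType} (x : R * R) : 'cV[R]_3 :=
  x.1 *: e_ 1 + x.2 *: e_ 2%:R.

Definition Scell {R : realType} : set (R * R) :=
  [set x | x.1 ^+ 2 + x.2 ^+ 2 < 1].

Definition Ycell {R : realType} : set R := `[0, 1[%classic.

Definition leb1 {R : realType} := @lebesgue_measure R.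
Definition leb2 {R : realType} :=
  (@lebesgue_measure R \x @lebesgue_measure R)%E.

(* The sigma-finite structure that the library attaches to products \x is
   found only for subprobabilities; it is needed for Fubini on (R * R) * R. *)
HB.instance Definition _ (R : realType) := Measure.on (@leb2 R).

Lemma leb2_sigma_finite (R : realType) : sigma_finite setT (@leb2 R).
Proof.
have /sigma_finiteP[F [TF ndF Foo]] := sigma_finiteT (@lebesgue_measure R).
exists (fun n => (F n `*` F n)%classic).
  rewrite -setXTT TF predeqE => -[x y]; split.
    move=> [/= [n _ Fnx] [k _ Fky]]; exists (maxn n k) => //; split.
    - by move: x Fnx; exact/subsetPset/ndF/leq_maxl.
    - by move: y Fky; exact/subsetPset/ndF/leq_maxr.
  by move=> [n _ []/= ? ?]; split; exists n.
move=> k; have [? ?] := Foo k.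
split; first exact: measurableX.
by rewrite /leb2 product_measure1E// lte_mul_pinfty// ge0_fin_numE.
Qed.

HB.instance Definition _ (R : realType) :=
  @Measure_isSigmaFinite.Build _ _ _ (@leb2 R) (@leb2_sigma_finite R).

Definition leb3 {R : realType} := (@leb2 R \x @lebesgue_measure R)%E.

Definition SY {R : realType} : set ((R * R) * R) := Scell `*` Ycell.

Definition L2 {R : realType} {d : measure_display} {T : measurableType d}
    (m : set T -> \bar R) (D : set T) (f : T -> R) : Prop :=
  measurable_fun D f /\ m.-integrable D (EFin \o (fun x => f x ^+ 2)).

Definition L2mx {R : realType} {d : measure_display} {T : measurableType d}
    (m : set T -> \bar R) (D : set T) (p q : nat) (F : T -> 'M[R]_(p, q)) :
    Prop :=
  forall i j, L2 m D (fun x => F x i j).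

(* Smooth 1-periodic functions are the test functions on the torus R/Z. *)
Definition test_torus {R : realType} (phi : R -> R) : Prop :=
  (forall (n : nat) (y : R), derivable (derive1n n phi) y 1) /\
  (forall y, phi (y + 1) = phi y).

(* f in H^1(R/Z) with weak derivative f' *)
Definition H1_torus {R : realType} (f f' : R -> R) : Prop :=
  [/\ L2 leb1 Ycell f, L2 leb1 Ycell f' &
      forall phi, test_torus phi ->
        (\int[leb1]_(y in Ycell) (f y * derive1 phi y)) =
        - (\int[leb1]_(y in Ycell) (f' y * phi y))].

(* Partial derivative with respect to x_2 (b = false) or x_3 (b = true) *)
Definition partial {R : realType} (b : bool) (f : R * R -> R) : R * R -> R :=
  fun x => 'D_((if b then (0, 1) else (1, 0)) : R * R) f x.

(* Differentiability of all iterated partial derivatives is smoothness. *)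
Definition smooth2 {R : realType} (f : R * R -> R) : Prop :=
  forall (s : seq bool) (x : R * R), differentiable (foldr partial f s) x.

(* C_c^oo(S) *)
Definition test_disc {R : realType} (phi : R * R -> R) : Prop :=
  [/\ smooth2 phi,
      compact (closure [set x | phi x != 0]) &
      closure [set x | phi x != 0] `<=` Scell].

(* f in H^1(S) with weak partial derivatives g2, g3 *)
Definition H1_disc {R : realType} (f g2 g3 : R * R -> R) : Prop :=
  [/\ L2 leb2 Scell f, L2 leb2 Scell g2, L2 leb2 Scell g3 &
      forall phi, test_disc phi ->
        (\int[leb2]_(x in Scell) (f x * partial false phi x)) =
          - (\int[leb2]_(x in Scell) (g2 x * phi x)) /\
        (\int[leb2]_(x in Scell) (f x * partial true phi x)) =
          - (\int[leb2]_(x in Scell) (g3 x * phi x))].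

Definition H1_torus_mx {R : realType} (p q : nat)
    (F F' : R -> 'M[R]_(p, q)) : Prop :=
  forall i j, H1_torus (fun y => F y i j) (fun y => F' y i j).

Definition H1_disc_cV {R : realType}
    (f : R * R -> 'cV[R]_3) (N : R * R -> 'M[R]_(3, 2)) : Prop :=
  forall i, H1_disc (fun x => f x i 0) (fun x => N x i 0) (fun x => N x i 1).

(* f in L^2(R/Z; H^1(S; R^3)) with gradient N: Bochner functions are
   represented by jointly measurable ones. *)
Definition L2_torus_H1_disc {R : realType}
    (f : (R * R) * R -> 'cV[R]_3) (N : (R * R) * R -> 'M[R]_(3, 2)) : Prop :=
  [/\ L2mx leb3 SY f, L2mx leb3 SY N &
      {ae leb1, forall y, Ycell y ->
        H1_disc_cV (fun x => f (x, y)) (fun x => N (x, y))}].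

(* f in L^2(S; H^1(R/Z; R^3)) with y-derivative f' *)
Definition L2_disc_H1_torus {R : realType}
    (f f' : (R * R) * R -> 'cV[R]_3) : Prop :=
  [/\ L2mx leb3 SY f, L2mx leb3 SY f' &
      {ae leb2, forall x, Scell x ->
        H1_torus_mx (fun y => f (x, y)) (fun y => f' (x, y))}].

Definition Q {R : realType} (mu lambda : R) (G : 'M[R]_3) : R :=
  2 * mu * fnorm (sym G) ^+ 2 + lambda * (\tr G) ^+ 2.

Definition LL {R : realType} (mu lambda : R) (F G : 'M[R]_3) : R :=
  2^-1 * (Q mu lambda (F + G) - Q mu lambda F - Q mu lambda G).

Definition tfield (R : realType) := (R * R) * R -> 'M[R]_3.

Definition inner {R : realType} (mu lambda : R) (F G : tfield R) : R :=
  \int[leb3]_(z in SY) LL mu lambda (F z) (G z).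

Definition ae_eq_SY {R : realType} (F G : tfield R) : Prop :=
  {ae leb3, forall z, SY z -> F z = G z}.

Definition Hspace {R : realType} (F : tfield R) : Prop :=
  L2mx leb3 SY F /\ {ae leb3, forall z, SY z -> symmetric3 (F z)}.

Definition EE {R : realType} (K : 'M[R]_3) (a : R) : tfield R :=
  fun z => sym (tensor (K *m xbold z.1 + a *: e_ 0) (e_ 0)).

(* (v | N) *)
Definition colmat {R : realType} (v : 'cV[R]_3) (N : 'M[R]_(3, 2)) :
  'M[R]_3 := row_mx v N.

(* The two regimes gamma = 0 and gamma = oo *)
Inductive regime : Set := Gamma0 | GammaInfty.

Definition Hrel0 {R : realType} (F : tfield R) : Prop :=
  Hspace F /\
  exists (Psi dPsi : R -> 'M[R]_3) (phih dphih : R -> 'cV[R]_3)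
         (phib : (R * R) * R -> 'cV[R]_3) (N : (R * R) * R -> 'M[R]_(3, 2)),
    [/\ H1_torus_mx Psi dPsi,
        {ae leb1, forall y, Ycell y -> skew3 (Psi y)},
        H1_torus_mx phih dphih,
        L2_torus_H1_disc phib N &
        ae_eq_SY F (fun z =>
          sym (colmat (dPsi z.2 *m xbold z.1 + dphih z.2) (N z)))].

Definition HrelInfty {R : realType} (F : tfield R) : Prop :=
  Hspace F /\
  exists (phih dphih : (R * R) * R -> 'cV[R]_3)
         (phib : R * R -> 'cV[R]_3) (N : R * R -> 'M[R]_(3, 2)),
    [/\ L2_disc_H1_torus phih dphih,
        H1_disc_cV phib N &
        ae_eq_SY F (fun z => sym (colmat (dphih z) (N z.1)))].

Definition Hrel {R : realType} (gamma : regime) : tfield R -> Prop :=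
  match gamma with Gamma0 => Hrel0 | GammaInfty => HrelInfty end.

Definition Hgamma {R : realType} (gamma : regime) (F : tfield R) : Prop :=
  Hspace F /\
  exists (K : 'M[R]_3) (a : R) (chi : tfield R),
    [/\ skew3 K, Hrel gamma chi & ae_eq_SY F (fun z => EE K a z + chi z)].

Definition Hrel_perp {R : realType} (mu lambda : R) (gamma : regime)
    (F : tfield R) : Prop :=
  Hgamma gamma F /\ forall chi, Hrel gamma chi -> inner mu lambda F chi = 0.

(* P is a representative of the orthogonal projection P_rel^gamma F. *)
Definition is_Prel {R : realType} (mu lambda : R) (gamma : regime)
    (F P : tfield R) : Prop :=
  Hrel_perp mu lambda gamma P /\
  forall V, Hrel_perp mu lambda gamma V ->
    inner mu lambda (fun z => F z - P z) V = 0.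

Definition omega {R : realType} (ell : R) : set R := `]0, ell[%classic.

Definition L2_skew {R : realType} (ell : R) (K : R -> 'M[R]_3) : Prop :=
  L2mx leb1 (omega ell) K /\
  {ae leb1, forall x1, omega ell x1 -> skew3 (K x1)}.

(* (K, a) is (K_eff, a_eff) for the prestrain B. *)
Definition is_eff {R : realType} (mu lambda ell : R) (gamma : regime)
    (B : R -> tfield R) (K : R -> 'M[R]_3) (a : R -> R) : Prop :=
  [/\ L2_skew ell K, L2 leb1 (omega ell) a &
      {ae leb1, forall x1, omega ell x1 ->
        exists P : tfield R,
          is_Prel mu lambda gamma (EE (K x1) (a x1)) P /\
          is_Prel mu lambda gamma (fun z => sym (B x1 z)) P}].

Definition Zset {R : realType} (theta alpha : R) : set ((R * R) * R) :=
  [set z | [/\ SY z, 0 <= z.2 < theta &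
    exists r phi : R, [/\ 0 <= r <= 1,
      alpha - pi / 2 <= phi < alpha + pi / 2 &
      z.1 = (r * cos phi, r * sin phi)]]].

Definition prestrain {R : realType} (theta alpha : R -> R) : R -> tfield R :=
  fun x1 z => (3 * pi / 8 * \1_(Zset (theta x1) (alpha x1)) z)%:M.

(* Main.v *)
(** The two-scale problem relaxes explicitly. Adding to [EE K a] the lateral
    contraction [- nu * (k . x + a)] with Poisson's ratio [nu], which is the
    symmetrized gradient of a quadratic displacement and hence lies in [Hrel],
    gives a field [relaxed K a] whose stress is uniaxial up to the torsion field
    (x_3, - x_2). Uniaxial stress is orthogonal to [Hrel] because the first
    columns of relaxation fields are y-derivatives of periodic functions, and
    the torsion field is orthogonal to gradients because it is divergence free
    and tangent to the circle. By positivity of the energy, the orthogonal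
    complement of [Hrel] in [Hgamma] consists exactly of the fields
    [relaxed K a], in both regimes.

    Projecting an isotropic prestrain [b Id] therefore amounts to projecting
    [b] in L^2 onto the affine functions of (x_2, x_3), and the bending part
    [k] of K_eff solves [pi / 4 * k = \int b x]. The first moment of the half
    disc of axis [(cos alpha, sin alpha)] being [2 / 3] times that axis, the
    given prestrain yields [k = theta * (cos alpha, sin alpha)]; so it suffices
    to take for [theta] and [alpha] the modulus and the angle of the first row
    of [K]. *)

Require Import Defs.
From HB Require Import structures.
From mathcomp Require Import all_boot all_order all_algebra.
From mathcomp Require Import all_classical all_reals all_analysis.
From mathcomp Require Import measurable_realfun ring lra.
Import Order.TTheory GRing.Theory Num.Theory.
Import numFieldNormedType.Exports.
Local Open Scope classical_set_scope.
Local Open Scope ring_scope.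

Set Implicit Arguments.
Unset Strict Implicit.
Unset Printing Implicit Defensive.

(** * Square-integrable functions and Fubini *)

(** Functions in H^1 of the disc are known here only through their weak derivatives, tested against
    compactly supported functions; boundary values on the circle are not at hand. This shapes the
    first half: the orthogonality of torsion to gradients must pass from compactly supported tests
    to the whole disc. Multiplying the rotation field by radial cutoffs keeps it divergence free, so
    no gradient of a cutoff appears and dominated convergence concludes. The cutoffs must be smooth
    to all orders, whence the functions p(1/t) e^(-1/t), a family stable under differentiation.

    Projections are exhibited, not produced by completeness: a field [relaxed K a] is checked
    against the definition of [is_Prel]. The two conclusions use the orthogonal complement
    differently. Existence of K_eff needs its full description, since every test field must be
    reached; the identification of K_eff e_1 only needs that torsion-free relaxed fields belong to
    it. *)

Section HasIntegral.
Context d (T : measurableType d) (R : realType).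
Variables (mu : {measure set T -> \bar R}) (D : set T).
Hypothesis mD : measurable D.
Implicit Types f g : T -> R.

(** [Rintegral] truncates an extended integral by [fine], so a value alone does not guarantee
    integrability. Carrying both lets linear combinations be formed without side conditions. *)
Definition has_integral f (c : R) : Prop :=
  mu.-integrable D (EFin \o f) /\ \int[mu]_(x in D) f x = c.

Lemma has_integral_integral f : mu.-integrable D (EFin \o f) ->
  has_integral f (\int[mu]_(x in D) f x).
Proof. by []. Qed.

Lemma has_integral_measurable f c : has_integral f c -> measurable_fun D f.
Proof. by case=> /integrableP[/measurable_EFinP]. Qed.

Lemma has_integralE f c : has_integral f c ->
  (\int[mu]_(x in D) (f x)%:E = c%:E)%E.
Proof.
by move=> [fi <-]; rewrite /Rintegral fineK//; exact: integrable_fin_num.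
Qed.

Lemma has_integralD f g a b : has_integral f a -> has_integral g b ->
  has_integral (fun x => f x + g x) (a + b).
Proof.
move=> [fi <-] [gi <-]; split; last by rewrite RintegralD.
exact: (integrableD mD fi gi).
Qed.

Lemma has_integralZ k f a : has_integral f a ->
  has_integral (fun x => k * f x) (k * a).
Proof.
move=> [fi <-]; split; last by rewrite RintegralZl.
exact: (integrableZl mD k fi).
Qed.

Lemma has_integralB f g a b : has_integral f a -> has_integral g b ->
  has_integral (fun x => f x - g x) (a - b).
Proof.
move=> fa /(has_integralZ (-1)) gb; have := has_integralD fa gb.
by rewrite mulN1r; under eq_fun do rewrite mulN1r.
Qed.

(** Measurability of [g] is asked separately because almost everywhere equality transfers it only
    for complete measures. *)
Lemma has_integral_ae f g a : measurable_fun D g ->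
  {ae mu, forall x, D x -> f x = g x} -> has_integral f a -> has_integral g a.
Proof.
move=> mg fg fa; have mf := has_integral_measurable fa.
have fge : ae_eq mu D (EFin \o f) (EFin \o g).
  by apply: filterS fg => x fg Dx /=; rewrite fg.
have fgi : (\int[mu]_(x in D) (f x)%:E = \int[mu]_(x in D) (g x)%:E)%E.
  by apply: ae_eq_integral => //; apply/measurable_EFinP.
split; last by rewrite /Rintegral -fgi (has_integralE fa).
apply/integrableP; split; first exact/measurable_EFinP.
rewrite (_ : (\int[mu]_(x in D) _ = \int[mu]_(x in D) `|(f x)%:E|)%E).
  by case: fa => /integrableP[].
apply: ae_eq_integral => //.
- by apply: measurableT_comp => //; apply/measurable_EFinP.
- by apply: measurableT_comp => //; apply/measurable_EFinP.
- by apply: filterS fg => x fg Dx /=; rewrite fg.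
Qed.

Lemma eq_has_integral f g a b : (forall x, D x -> f x = g x) -> a = b ->
  has_integral f a -> has_integral g b.
Proof.
move=> fg <- [fi fa]; split.
  by apply: eq_integrable fi => // x; rewrite inE => Dx /=; rewrite fg.
by rewrite -fa; apply: eq_Rintegral => x; rewrite inE => Dx; rewrite fg.
Qed.

Lemma has_integral0 : has_integral (fun=> 0) 0.
Proof.
by split; [exact: integrable0|rewrite /Rintegral integral0].
Qed.

Lemma has_integral_sum (I : Type) (s : seq I) (h : I -> T -> R) (c : I -> R) :
  (forall i, has_integral (h i) (c i)) ->
  has_integral (fun x => \sum_(i <- s) h i x) (\sum_(i <- s) c i).
Proof.
move=> hc; elim: s => [|i s IH].
  by rewrite big_nil; under eq_fun do rewrite big_nil; exact: has_integral0.
rewrite big_cons; under eq_fun do rewrite big_cons; exact: has_integralD.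
Qed.

Lemma has_integral_uniq f a b : has_integral f a -> has_integral f b -> a = b.
Proof. by move=> [_ <-] [_ <-]. Qed.

Lemma has_integral_ge0_eq0 f : (forall x, D x -> 0 <= f x) ->
  has_integral f 0 -> {ae mu, forall x, D x -> f x = 0}.
Proof.
move=> f0 fh; have mf := has_integral_measurable fh.
have /(ae_eq_integral_abs mu mD) : measurable_fun D (EFin \o f).
  exact/measurable_EFinP.
move=> [+ _] => /(_ _)/wrap[].
  rewrite -[RHS](has_integralE fh); apply: eq_integral => x.
  by rewrite inE => Dx /=; rewrite ger0_norm// f0.
by apply: filterS => x /= h Dx; have [] := h Dx.
Qed.

(** Expanding the squares of f + g and f - g shows that |f g| is dominated by f^2 + g^2. *)
Lemma L2_sqr_integrable f g : L2 mu D f -> L2 mu D g ->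
  mu.-integrable D (EFin \o (fun x => f x * g x)).
Proof.
move=> [mf fi] [mg gi].
apply: (@le_integrable _ _ _ mu D mD _
    ((EFin \o (fun x => (f x ^+ 2)%R)) \+ (EFin \o (fun x => (g x ^+ 2)%R)))%E).
- by apply/measurable_EFinP; exact: measurable_funM.
- move=> x Dx /=; rewrite lee_fin [leRHS]ger0_norm ?addr_ge0 ?sqr_ge0//.
  rewrite ler_norml; apply/andP; split.
    have := sqr_ge0 (f x + g x); have := sqr_ge0 (f x); have := sqr_ge0 (g x).
    by rewrite sqrrD; nra.
  have := sqr_ge0 (f x - g x); have := sqr_ge0 (f x); have := sqr_ge0 (g x).
  by rewrite sqrrB; nra.
- exact: integrableD.
Qed.

Lemma L2_le f g : measurable_fun D f -> L2 mu D g ->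
  (forall x, D x -> `|f x| <= `|g x|) -> L2 mu D f.
Proof.
move=> mf [mg gi] fg; split => //; apply: (le_integrable mD _ _ gi).
  by apply/measurable_EFinP; exact: measurable_funX.
move=> x Dx /=; rewrite lee_fin !normrX.
by rewrite lerXn2r// ?nnegrE// fg.
Qed.

Lemma L2D f g : L2 mu D f -> L2 mu D g -> L2 mu D (fun x => f x + g x).
Proof.
move=> f2 g2; have fg := L2_sqr_integrable f2 g2; case: f2 g2 => mf fi [mg gi].
split; first exact: measurable_funD.
rewrite (_ : _ \o _ = ((EFin \o (fun x => (f x ^+ 2)%R)) \+
  ((fun x => 2%:E * (EFin \o (fun x => (f x * g x)%R)) x) \+
     (EFin \o (fun x => (g x ^+ 2)%R))))%E).
  by do 2!apply: integrableD => //; exact: integrableZl.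
apply/funext => x /=; rewrite -EFinM -!EFinD; congr EFin.
by rewrite sqrrD mulr_natl -addrA.
Qed.

Lemma L2Z k f : L2 mu D f -> L2 mu D (fun x => k * f x).
Proof.
move=> [mf fi]; split; first exact: measurable_funM.
rewrite (_ : _ \o _ = fun x => (k ^+ 2)%:E * (EFin \o (fun x => (f x ^+ 2)%R)) x)%E.
  exact: integrableZl.
by apply/funext => x /=; rewrite -EFinM exprMn.
Qed.

Lemma L2B f g : L2 mu D f -> L2 mu D g -> L2 mu D (fun x => f x - g x).
Proof.
move=> f2 /(L2Z (-1)) g2; have := L2D f2 g2.
by under eq_fun do rewrite mulN1r.
Qed.

Lemma L2_mul_bounded f g c : L2 mu D f -> measurable_fun D g ->
  (forall x, D x -> `|g x| <= c) -> L2 mu D (fun x => f x * g x).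
Proof.
move=> f2 mg gc; apply: (@L2_le _ (fun x => c * f x)) (L2Z c f2) _.
  by apply: measurable_funM => //; case: f2.
move=> x Dx; rewrite !normrM mulrC ler_wpM2r//.
by rewrite (le_trans (gc _ Dx))// ler_norm.
Qed.

Hypothesis finD : (mu D < +oo)%E.

Lemma integrable_bounded f c : measurable_fun D f ->
  (forall x, D x -> `|f x| <= c) -> mu.-integrable D (EFin \o f).
Proof.
move=> mf fc; apply: measurable_bounded_integrable => //.
exists c; split; first exact: num_real.
by move=> M cM x Dx; rewrite /= (le_trans (fc _ Dx))// ltW.
Qed.

Lemma L2_bounded f c : measurable_fun D f ->
  (forall x, D x -> `|f x| <= c) -> L2 mu D f.
Proof.
move=> mf fc; split => //; apply: (@integrable_bounded _ (c ^+ 2)).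
  exact: measurable_funX.
by move=> x Dx; rewrite normrX lerXn2r ?nnegrE ?fc// (le_trans _ (fc _ Dx)).
Qed.

Lemma L2_integrable f : L2 mu D f -> mu.-integrable D (EFin \o f).
Proof.
move=> f2; have /(L2_sqr_integrable f2) : L2 mu D (fun=> 1).
  by apply: (@L2_bounded _ 1) => // x _; rewrite normr1.
by under eq_fun do rewrite mulr1.
Qed.

Lemma L2_mul_bounded_integrable f g c : L2 mu D f -> measurable_fun D g ->
  (forall x, D x -> `|g x| <= c) ->
  mu.-integrable D (EFin \o (fun x => f x * g x)).
Proof. by move=> f2 mg gc; apply/L2_integrable/(L2_mul_bounded f2 mg gc). Qed.

End HasIntegral.

Section Fubini.
Context d d' (T1 : measurableType d) (T2 : measurableType d') (R : realType).
Variables (m1 : {sigma_finite_measure set T1 -> \bar R})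
  (m2 : {sigma_finite_measure set T2 -> \bar R}) (D : set (T1 * T2)).
Hypothesis mD : measurable D.
Variable f : T1 * T2 -> R.
Hypothesis fi : (m1 \x m2)%E.-integrable D (EFin \o f).

Let fi' : (m1 \x m2)%E.-integrable setT ((EFin \o f) \_ D).
Proof. exact: (integrable_mkcond _ mD).1. Qed.

(** The inner integral is prescribed as an explicit [g] that has to agree with it only almost
    everywhere, since weak derivatives are controlled on almost every slice. Extending [f] by zero
    off [D] and [g] by zero off [A] reduces the claim to the whole product space. *)
Lemma Rfubini1 (A : set T1) (g : T1 -> R) : measurable A ->
  measurable_fun A g ->
  {ae m1, forall x, ~ A x -> xsection D x = set0} ->
  {ae m1, forall x, A x -> \int[m2]_(y in xsection D x) f (x, y) = g x} ->
  has_integral m1 A g (\int[(m1 \x m2)%E]_(z in D) f z).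
Proof.
move=> mA mg gA fg.
have E x : (\int[m2]_y ((EFin \o f) \_ D) (x, y) =
            \int[m2]_(y in xsection D x) (f (x, y))%:E)%E.
  rewrite [RHS]integral_mkcond; apply: eq_integral => y _.
  by rewrite !patchE mem_xsection.
have Fae : {ae m1, forall x, setT x ->
    (fubini_F m2 ((EFin \o f) \_ D) x = ((EFin \o g) \_ A) x)%E}.
  have := ae_integrable1 fi'; apply: filterS3 fg gA => x fg gA fx _.
  rewrite /fubini_F E patchE; case: ifPn => [|/negP]; rewrite inE => Ax.
    rewrite /= -fg// /Rintegral fineK//.
    by rewrite -E; exact: integrable_fin_num.
  by rewrite gA// integral_set0.
have mgA : measurable_fun setT ((EFin \o g) \_ A).
  by apply/(measurable_restrictT _ mA)/measurable_EFinP.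
have iF := integrable_fubini_F fi'.
have iE : (\int[m1]_(x in A) (g x)%:E = \int[m1 \x m2]_(z in D) (f z)%:E)%E.
  rewrite [RHS]integral_mkcond -integral12_prod_meas1//.
  rewrite integral_mkcond; apply: ae_eq_integral => //.
  - exact: measurable_int iF.
  - by apply: filterS Fae => x /= h _; rewrite -h.
split; last by rewrite /Rintegral iE.
apply/(integrable_mkcond _ mA).2/integrableP; split => //.
have /integrableP[mF] := iF.
congr (_ < _)%E; apply: ae_eq_integral => //.
- exact: measurableT_comp.
- exact: measurableT_comp.
- by apply: filterS Fae => x /= h _; rewrite -h.
Qed.

Lemma Rfubini2 (A : set T2) (g : T2 -> R) : measurable A ->
  measurable_fun A g ->
  {ae m2, forall y, ~ A y -> ysection D y = set0} ->
  {ae m2, forall y, A y -> \int[m1]_(x in ysection D y) f (x, y) = g y} ->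
  has_integral m2 A g (\int[(m1 \x m2)%E]_(z in D) f z).
Proof.
move=> mA mg gA fg.
have E y : (\int[m1]_x ((EFin \o f) \_ D) (x, y) =
            \int[m1]_(x in ysection D y) (f (x, y))%:E)%E.
  rewrite [RHS]integral_mkcond; apply: eq_integral => x _.
  by rewrite !patchE mem_ysection.
have Fae : {ae m2, forall x, setT x ->
    (fubini_G m1 ((EFin \o f) \_ D) x = ((EFin \o g) \_ A) x)%E}.
  have := ae_integrable2 fi'; apply: filterS3 fg gA => x fg gA fx _.
  rewrite /fubini_G E patchE; case: ifPn => [|/negP]; rewrite inE => Ax.
    rewrite /= -fg// /Rintegral fineK//.
    by rewrite -E; exact: integrable_fin_num.
  by rewrite gA// integral_set0.
have mgA : measurable_fun setT ((EFin \o g) \_ A).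
  by apply/(measurable_restrictT _ mA)/measurable_EFinP.
have mG := measurable_fubini_G fi'.
(* Integrability of the iterated integral in this order: its absolute value is at most the inner
   integral of |f|, which is integrable by Tonelli. *)
have iG : m2.-integrable setT (fubini_G m1 ((EFin \o f) \_ D)).
  apply/integrableP; split => //.
  have /(integrable21ltyP _ _ _).1 := fi'.
  move=> /(_ (measurable_int _ fi')); apply: le_lt_trans.
  apply: ge0_le_integral => //.
  - exact: measurableT_comp.
  - apply: (measurable_fun_fubini_tonelli_G (abse \o _)) => //=.
    by apply: measurableT_comp => //; exact: measurable_int fi'.
  - move=> y _; apply: le_abse_integral => //.
    exact: measurable_fun_pair1 (measurable_int _ fi').
have iE : (\int[m2]_(x in A) (g x)%:E = \int[m1 \x m2]_(z in D) (f z)%:E)%E.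
  rewrite [RHS]integral_mkcond -integral21_prod_meas1//.
  rewrite integral_mkcond; apply: ae_eq_integral => //.
  by apply: filterS Fae => x /= h _; rewrite -h.
split; last by rewrite /Rintegral iE.
apply/(integrable_mkcond _ mA).2/integrableP; split => //.
have /integrableP[_] := iG.
congr (_ < _)%E; apply: ae_eq_integral => //.
- exact: measurableT_comp.
- exact: measurableT_comp.
- by apply: filterS Fae => x /= h _; rewrite -h.
Qed.

End Fubini.

(** * Integration by parts on the disc *)

Section FlatExp.
Context {R : realType}.
Implicit Types (p : {poly R}) (t s : R).

(** For [p = 1] this is the classical function e^(-1/t), flat at 0. Polynomial factors in 1/t are
    included to make the family stable under differentiation. *)
Definition flat_exp p t : R :=
  if 0 < t then p.[t^-1] * expR (- t^-1) else 0.

(** Each monomial satisfies s^i <= i! e^s, by the exponential series. *)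
Lemma horner_expRN_bounded p :
  exists C, forall s, 0 <= s -> `|p.[s] * expR (- s)| <= C.
Proof.
exists (\sum_(i < size p) `|p`_i| * i`!%:R) => s s0.
rewrite horner_coef normrM [`|expR _|]ger0_norm ?expR_ge0//.
apply: (@le_trans _ _ ((\sum_(i < size p) `|p`_i| * s ^+ i) * expR (- s))).
  rewrite ler_wpM2r ?expR_ge0//; apply: (le_trans (ler_norm_sum _ _ _)).
  by apply: ler_sum => i _; rewrite normrM [`|s ^+ i|]ger0_norm// exprn_ge0.
rewrite big_distrl/=; apply: ler_sum => i _.
rewrite -mulrA ler_wpM2l// expRN ler_pdivrMr ?expR_gt0//.
case: (nat_of_ord i) => [|n].
  by rewrite expr0 fact0 mul1r -[leLHS]expR0 ler_expR.
have := @expR_ge1Dxn R s n s0; have := expR_ge0 s.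
have f0 : 0 < n.+1`!%:R :> R by rewrite ltr0n fact_gt0.
move=> _ H; rewrite mulrC -ler_pdivrMr//; apply: le_trans H.
by rewrite lerDr.
Qed.

(** For t > 0, differentiating p(1/t) and e^(-1/t) each produces a factor 1/t^2, with signs - p' and
    + p; this is the polynomial X^2 (p - p'). For t < 0 both functions vanish, and 0 is treated by
    hand. *)
Lemma is_derive_flat_exp p t :
  is_derive t 1 (flat_exp p) (flat_exp ('X^2 * (p - p^`())) t).
Proof.
have [t0|t0|->] := ltgtP t 0.
- apply: (@near_eq_is_derive _ _ _ (cst 0)).
    near=> x; rewrite /flat_exp ifF//; apply/negbTE; rewrite -leNgt ltW//.
    by near: x; exact: lt_nbhsl.
  rewrite [X in is_derive _ _ _ X](_ : _ = 0); first exact: is_derive_cst.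
  by rewrite /flat_exp ifF//; apply/negbTE; rewrite -leNgt ltW.
- have t_neq0 : t != 0 by rewrite gt_eqF.
  apply: (@near_eq_is_derive _ _ _
    (fun x : R => p.[x^-1] * expR (- x^-1) : R)).
    by near=> x; rewrite /flat_exp ifT//; near: x; exact: lt_nbhsr.
  have dV : is_derive t 1 (fun x : R => x^-1) (- t ^- 2).
    by have := is_deriveV t_neq0 (is_derive_id t 1); rewrite scaler1.
  have dp := is_derive1_comp (is_derive_poly p t^-1) dV.
  have dN := is_deriveN dV.
  have de := @is_derive1_comp _ expR (fun x => - x^-1) t _ _
    (is_derive_expR (- t^-1)) dN.
  have := is_deriveM dp de; rewrite [X in is_derive _ _ _ X -> _](_ : _ =
     flat_exp ('X^2 * (p - p^`())) t) //.
  rewrite /flat_exp t0 !hornerE /= /GRing.scale /=.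
  by rewrite exprVn opprK; ring.
- have -> : flat_exp ('X^2 * (p - p^`())) 0 = 0 by rewrite /flat_exp ltxx.
  (* For h > 0 the difference quotient at 0 is (X p)(1/h) e^(-1/h). Dividing it by h gives the
     bounded function attached to X^2 p, so the quotient is at most C h. *)
  have [C HC] := horner_expRN_bounded ('X^2 * p).
  have H : (h^-1 *: ((flat_exp p \o shift 0) (h *: 1) - flat_exp p 0)) @[h --> 0^'] --> (0:R).
    apply: (@cvg_to_0_linear _ _ C 1) => // h /andP[h0 _].
    rewrite /shift/= [h *: 1]mulr1 addr0 /flat_exp ltxx subr0.
    have C0 : 0 <= C by rewrite (le_trans _ (HC 0 _)).
    case: ifPn => [{}h0|_]; last by rewrite scaler0 normr0 mulr_ge0.
    have h_neq0 : h != 0 by rewrite gt_eqF.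
    rewrite [`|h|]gtr0_norm// -ler_pdivrMr//; apply: le_trans (HC h^-1 _).
      rewrite !hornerE /GRing.scale/= !normrM [`|h^-1|]gtr0_norm ?invr_gt0//.
      by rewrite le_eqVlt; apply/orP; left; apply/eqP; ring.
    by rewrite invr_ge0 ltW.
  by apply: DeriveDef; [apply: cvgP H | apply: cvg_lim H].
Unshelve. all: by end_near. Qed.

Lemma flat_exp1_bound t : 0 <= flat_exp 1 t <= 1.
Proof.
rewrite /flat_exp; case: ifPn => t0; last by rewrite lexx ler01.
rewrite hornerC mul1r expR_ge0/= -[leRHS]expR0 ler_expR oppr_le0 invr_ge0.
exact: ltW.
Qed.

Lemma flat_exp_le0 p t : t <= 0 -> flat_exp p t = 0.
Proof. by rewrite /flat_exp ltNge => ->. Qed.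

Lemma cvg_flat_exp1 (a : R) : 0 < a ->
  flat_exp 1 (n%:R * a - 1) @[n --> \oo] --> (1 : R).
Proof.
move=> a0; apply: (@cvg_trans _ (expR (- (n%:R * a - 1)^-1) @[n --> \oo])).
  apply: near_eq_cvg; near=> n.
  rewrite /flat_exp ifT ?hornerC ?mul1r//.
  rewrite subr_gt0 -ltr_pdivrMr//; near: n; exact: nbhs_infty_gtr.
suff: expR (- (n%:R * a - 1)^-1) @[n --> \oo] --> expR (- (0 : R)).
  by rewrite oppr0 expR0.
apply: (@cvg_comp _ _ _ (fun n => - (n%:R * a - 1)^-1) expR _ (nbhs (- 0)));
  last exact: continuous_expR.
apply: cvgN; apply/gtr0_cvgV0.
  near=> n; rewrite subr_gt0 -ltr_pdivrMr//; near: n; exact: nbhs_infty_gtr.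
apply/cvgryPge => M; near=> n.
rewrite lerBrDr -ler_pdivrMr//; near: n; exact: nbhs_infty_ger.
Unshelve. all: by end_near. Qed.

End FlatExp.

Section Smooth.
Context {R : realType}.
Implicit Types f g : R * R -> R.

(* A class of smooth functions, closed under partial differentiation, that
   contains both the polynomials and the bump functions. *)
Inductive elementary : (R * R -> R) -> Prop :=
| elementary_fst : elementary (fun x => x.1)
| elementary_snd : elementary (fun x => x.2)
| elementary_cst c : elementary (fun=> c)
| elementaryD f g : elementary f -> elementary g ->
    elementary (fun x => f x + g x)
| elementaryM f g : elementary f -> elementary g ->
    elementary (fun x => f x * g x)
| elementary_flat_exp (p : {poly R}) f : elementary f ->
    elementary (fun x => flat_exp p (f x)).

Lemma partialE b f x : differentiable f x ->
  partial b f x = 'd f x (if b then (0, 1) else (1, 0)).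
Proof. exact: deriveE. Qed.

Lemma differentiable_fst (x : R * R) : differentiable (fun z : R * R => z.1) x.
Proof.
apply: (@linear_differentiable R (R^o * R^o)%type R^o fst).
by move=> ?; exact: cvg_fst.
Qed.

Lemma differentiable_snd (x : R * R) : differentiable (fun z : R * R => z.2) x.
Proof.
apply: (@linear_differentiable R (R^o * R^o)%type R^o snd).
by move=> ?; exact: cvg_snd.
Qed.

Lemma partial_fst b : partial b (fun z : R * R => z.1) = fun=> (~~ b)%:R.
Proof.
apply/funext => x; rewrite partialE; last exact: differentiable_fst.
rewrite (@diff_lin R (R^o * R^o)%type R^o fst); last by move=> ?; exact: cvg_fst.
by case: b.
Qed.

Lemma partial_snd b : partial b (fun z : R * R => z.2) = fun=> b%:R.
Proof.
apply/funext => x; rewrite partialE; last exact: differentiable_snd.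
rewrite (@diff_lin R (R^o * R^o)%type R^o snd); last by move=> ?; exact: cvg_snd.
by case: b.
Qed.

Lemma partial_cst b (c : R) : partial b (fun=> c) = fun=> 0.
Proof. by apply/funext => x; rewrite /partial derive_cst. Qed.

Lemma partialD b f g : (forall x, differentiable f x) ->
  (forall x, differentiable g x) ->
  partial b (fun x => f x + g x) = fun x => partial b f x + partial b g x.
Proof.
move=> df dg; apply/funext => x.
by rewrite /partial deriveD//; exact: diff_derivable.
Qed.

Lemma partialM b f g : (forall x, differentiable f x) ->
  (forall x, differentiable g x) ->
  partial b (fun x => f x * g x) =
  fun x => f x * partial b g x + g x * partial b f x.
Proof.
move=> df dg; apply/funext => x.
by rewrite /partial deriveM//; exact: diff_derivable.
Qed.

Lemma partial_flat_exp b p f : (forall x, differentiable f x) ->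
  partial b (fun x => flat_exp p (f x)) =
  fun x => flat_exp ('X^2 * (p - p^`())) (f x) * partial b f x.
Proof.
move=> df; apply/funext => x.
have [dp Dp] := is_derive_flat_exp p (f x).
have {}dp : differentiable (flat_exp p) (f x) by exact/derivable1_diffP.
rewrite !partialE//; last exact: (differentiable_comp (df x) dp).
rewrite (diff_comp (df x) dp) /= diff1E// derive1E Dp.
exact: mulrC.
Qed.

Lemma differentiable_elementary f x : elementary f -> differentiable f x.
Proof.
move=> ef; elim: ef x => {f}.
- exact: differentiable_fst.
- exact: differentiable_snd.
- by move=> c x; exact: differentiable_cst.
- by move=> f g _ df _ dg x; exact: differentiableD.
- by move=> f g _ df _ dg x; exact: differentiableM.
- move=> p f _ df x; apply: (differentiable_comp (df x)).
  by apply/derivable1_diffP; have [] := is_derive_flat_exp p (f x).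
Qed.

Lemma elementary_partial b f : elementary f -> elementary (partial b f).
Proof.
elim=> {f}.
- by rewrite partial_fst; exact: elementary_cst.
- by rewrite partial_snd; exact: elementary_cst.
- by move=> c; rewrite partial_cst; exact: elementary_cst.
- move=> f g ef df eg dg; rewrite partialD; first exact: elementaryD.
    by move=> x; exact: differentiable_elementary.
  by move=> x; exact: differentiable_elementary.
- move=> f g ef df eg dg; rewrite partialM.
  + by apply: elementaryD; exact: elementaryM.
  + by move=> x; exact: differentiable_elementary.
  + by move=> x; exact: differentiable_elementary.
- move=> p f ef df; rewrite partial_flat_exp.
    by apply: elementaryM => //; exact: elementary_flat_exp.
  by move=> x; exact: differentiable_elementary.
Qed.

Lemma smooth2_elementary f : elementary f -> smooth2 f.
Proof.
move=> ef s x; apply: differentiable_elementary.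
by elim: s => //= b s; exact: elementary_partial.
Qed.

End Smooth.

(** * Measurability, weak derivatives and cutoffs on the unit disc *)

Section Plane.
Context {R : realType}.
Local Notation mR := (measurableTypeR R).

(** Openness is topological while the sigma-algebra is generated by rectangles. The link is that [U]
    is the countable union of the boxes with rational corners that it contains. *)
Lemma measurable_open_prod (U : set (R * R)) : open U ->
  measurable (U : set (mR * mR)).
Proof.
move=> oU.
pose box (q : (rat * rat) * (rat * rat)) : set (mR * mR) :=
  `]ratr q.1.1, ratr q.1.2[%classic `*` `]ratr q.2.1, ratr q.2.2[%classic.
pose F n := if unpickle n is Some q then
  if `[< box q `<=` U >] then box q else set0 else set0.
rewrite (_ : U = \bigcup_n F n).
  apply: bigcupT_measurable => n; rewrite /F; case: unpickle => // q.
  by case: ifPn => // _; exact: measurableX.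
apply/seteqP; split => [[x y] Uxy|x [n _]].
  have /nbhs_ballP[e /= e0 eU] : nbhs (x, y) U by exact: open_nbhs_nbhs.
  have aux (t : R) : exists q : rat * rat,
      ratr q.1 < t < ratr q.2 /\
      (forall s : R, ratr q.1 < s < ratr q.2 -> `|t - s| < e).
    have [q1] : exists q : rat, ratr q \in `]t - e, t[.
      by apply: rat_in_itvoo; rewrite ltrBlDr ltrDl.
    rewrite in_itv/= => /andP[q1a q1b].
    have [q2] : exists q : rat, ratr q \in `]t, t + e[.
      by apply: rat_in_itvoo; rewrite ltrDl.
    rewrite in_itv/= => /andP[q2a q2b].
    exists (q1, q2); split; first by rewrite q1b.
    move=> s /andP[/= sa sb].
    by rewrite ltr_norml; lra.
  have [q1 [xq1 q1e]] := aux x; have [q2 [xq2 q2e]] := aux y.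
  have := pickleK (q1, q2); move: (pickle (q1, q2)) => n nq.
  exists n; first exact: I.
  rewrite /F nq; case: ifPn => [_|/asboolP[]].
    by split; rewrite /= in_itv/=.
  move=> [s t] [/=]; rewrite !in_itv/= => sq tq; apply: eU.
  by split => /=; [exact: q1e|exact: q2e].
rewrite /F; case: unpickle => // q; case: ifPn => // /asboolP; exact.
Qed.

Lemma measurable_continuous_prod (f : R * R -> R) (D : set (mR * mR)) :
  continuous f -> measurable_fun D (f : mR * mR -> R).
Proof.
move=> cf; apply: measurable_funTS.
apply: (measurability _ (RGenOInfty.measurableE R)).
move=> _ [_ [a ->]] <-; rewrite setTI; apply: measurable_open_prod.
apply: open_comp; first by move=> x _; exact: cf.
exact: rray_open.
Qed.

Lemma Scell_box : @Scell R `<=` `[-1, 1] `*` `[-1, 1].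
Proof.
move=> [x y]; rewrite /Scell/= => h; split; rewrite /= in_itv/=; apply/andP.
  by split; have := sqr_ge0 y; nra.
by split; have := sqr_ge0 x; nra.
Qed.

Lemma Scell_le1 (x : R * R) : Scell x -> `|x.1| <= 1 /\ `|x.2| <= 1.
Proof. by move=> /Scell_box[/= + +]; rewrite !in_itv/= -!ler_norml. Qed.

Lemma measurable_Scell : measurable (@Scell R : set (mR * mR)).
Proof.
rewrite (_ : Scell = setT `&` (fun x : mR * mR => x.1 ^+ 2 + x.2 ^+ 2 : R) @^-1` `]-oo, 1[).
  apply: (measurable_funD _ _) => //.
    by apply: measurable_funX; exact: measurable_fst.
  by apply: measurable_funX; exact: measurable_snd.
by apply/seteqP; split => x /=; rewrite in_itv/= => //; tauto.
Qed.

Lemma leb2_Scell_fin : ((@leb2 R) Scell < +oo)%E.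
Proof.
apply: (@le_lt_trans _ _ (leb2 (`[-1, 1]%classic `*` `[-1, 1]%classic : set (mR * mR)))).
  apply: le_measure; rewrite ?inE//; [exact: measurable_Scell| |exact: Scell_box].
  exact: measurableX.
rewrite /leb2 product_measure1E//.
have L : (@lebesgue_measure R `[(-1)%R, 1%R]%classic < +oo)%E.
  by rewrite lebesgue_measure_itv/= lte_fin; case: ifP => _; rewrite ltry.
by apply: lte_mul_pinfty => //; rewrite ge0_fin_numE.
Qed.

Lemma continuous_bounded_Scell (f : R * R -> R) : continuous f ->
  exists c, forall x, Scell x -> `|f x| <= c.
Proof.
move=> cf; have : compact (f @` (`[-1, 1]%classic `*` `[-1, 1]%classic)).
  apply: continuous_compact; first exact: continuous_subspaceT.
  by apply: compact_setX; exact: segment_compact.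
move=> /compact_bounded[M [_ HM]]; exists (M + 1) => x /Scell_box Sx.
by apply: (HM (M + 1)); [rewrite ltrDl|exists x].
Qed.

Lemma continuous_L2_Scell (f : R * R -> R) : continuous f -> L2 leb2 Scell f.
Proof.
move=> cf; have [c fc] := continuous_bounded_Scell cf.
apply: (@L2_bounded _ _ _ _ _ measurable_Scell leb2_Scell_fin _ c) => //.
exact: measurable_continuous_prod.
Qed.

Lemma L2_mul_continuous_Scell (f g : R * R -> R) : L2 leb2 Scell f ->
  continuous g -> leb2.-integrable Scell (EFin \o (fun x => f x * g x)).
Proof.
move=> f2 cg; have [c gc] := continuous_bounded_Scell cg.
apply: (@L2_mul_bounded_integrable _ _ _ _ _ measurable_Scell leb2_Scell_fin _ _ c) => //.
exact: measurable_continuous_prod.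
Qed.

Lemma is_derive_slice1 (u : R * R -> R) (s t : R) : differentiable u (s, t) ->
  is_derive s 1 (fun x => u (x, t)) (partial false u (s, t)).
Proof.
move=> /diff_derivable => /(_ (1, 0)) du.
have E : (fun h : R => h^-1 *: (((fun x => u (x, t)) \o shift s) (h *: 1) - u (s, t))) =
  (fun h : R => h^-1 *: ((u \o shift (s, t)) (h *: (1, 0)) - u (s, t))).
  apply/funext => h; congr (_ *: (u _ - _)).
  have E0 : h * 0 + t = t by rewrite mulr0 add0r.
  by rewrite /shift /=; congr pair; exact: esym E0.
by apply: DeriveDef; rewrite /derivable/= ?E// /derive/= E.
Qed.

Lemma is_derive_slice2 (u : R * R -> R) (s t : R) : differentiable u (s, t) ->
  is_derive t 1 (fun x => u (s, x)) (partial true u (s, t)).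
Proof.
move=> /diff_derivable => /(_ (0, 1)) du.
have E : (fun h : R => h^-1 *: (((fun x => u (s, x)) \o shift t) (h *: 1) - u (s, t))) =
  (fun h : R => h^-1 *: ((u \o shift (s, t)) (h *: (0, 1)) - u (s, t))).
  apply/funext => h; congr (_ *: (u _ - _)).
  have E0 : h * 0 + s = s by rewrite mulr0 add0r.
  by rewrite /shift /=; congr pair; exact: esym E0.
by apply: DeriveDef; rewrite /derivable/= ?E// /derive/= E.
Qed.

Lemma FTC_vanishing (v dv : R -> R) : (forall s : R, is_derive s 1 v (dv s)) ->
  continuous dv -> v (-1) = 0 -> v 1 = 0 ->
  \int[leb1]_(s in `[-1, 1]) dv s = 0.
Proof.
move=> dvE cdv v0 v1.
have cv : continuous v.
  by move=> s; apply/differentiable_continuous/derivable1_diffP; have [] := dvE s.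
rewrite /Rintegral (@continuous_FTC2 _ dv v (-1) 1) ?v0 ?v1 ?subee//.
- exact: continuous_subspaceT.
- split; first by move=> x _; have [] := dvE x.
    exact/cvg_at_right_filter/cv.
  exact/cvg_at_left_filter/cv.
- by move=> x _; rewrite derive1E; have [] := dvE x.
Qed.

Lemma continuous_slice1 (c : R * R -> R) (t : R) : continuous c ->
  continuous (fun s : R => c (s, t)).
Proof.
move=> cc s; apply: (@continuous_comp _ _ _ (fun s : R => (s, t)) c) => //.
apply: (@cvg_pair _ _ _ _ (nbhs s) (nbhs t)); [exact: cvg_id|exact: cvg_cst].
exact: cc.
Qed.

Lemma continuous_slice2 (c : R * R -> R) (s : R) : continuous c ->
  continuous (fun t : R => c (s, t)).
Proof.
move=> cc t; apply: (@continuous_comp _ _ _ (fun t : R => (s, t)) c) => //.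
apply: (@cvg_pair _ _ _ _ (nbhs s) (nbhs t)); [exact: cvg_cst|exact: cvg_id].
exact: cc.
Qed.

(** On a line parallel to the direction of differentiation, the chord may be replaced by [-1, 1],
    because the partial derivative vanishes outside the disc. The fundamental theorem then gives 0,
    the end points being outside the open disc, where [u] vanishes. *)
Lemma integral_partial_eq0 b (u : R * R -> R) : (forall x, differentiable u x) ->
  continuous (partial b u) -> (forall x, ~ Scell x -> u x = 0) ->
  (forall x, ~ Scell x -> partial b u x = 0) ->
  has_integral leb2 Scell (partial b u) 0.
Proof.
move=> du cu u0 pu0.
have ui : leb2.-integrable Scell (EFin \o partial b u).
  apply: (L2_integrable measurable_Scell leb2_Scell_fin).
  exact: continuous_L2_Scell.
split=> //.
have NS (s t : R) : s ^+ 2 = 1 -> ~ Scell (s, t) /\ ~ Scell (t, s).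
  by rewrite /Scell/= => ->; have := sqr_ge0 t; split => ?; lra.
case: b cu ui pu0 => cu ui pu0.
- apply: (@has_integral_uniq _ mR R (@lebesgue_measure R) setT (fun=> 0));
    last exact: has_integral0.
  apply: (@Rfubini1 _ _ mR mR R (@lebesgue_measure R) (@lebesgue_measure R) _
    measurable_Scell _ ui setT (fun=> 0)) => //; first by apply: aeW => s /(_ I).
  apply: aeW => s _.
  rewrite Rintegral_mkcond; transitivity
     (\int[leb1]_(t in `[-1, 1]) partial true u (s, t)).
    rewrite [RHS]Rintegral_mkcond; congr (Rintegral _ _ _); apply/funext => t.
    rewrite !patchE; case: ifPn => [|/negP]; rewrite mem_xsection inE => St.
      rewrite ifT// inE/= in_itv/= -ler_norml.
      by have [] := Scell_le1 St.
    by rewrite pu0// if_same.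
  apply: (@FTC_vanishing (fun t => u (s, t))).
  + by move=> t; exact: is_derive_slice2.
  + exact: (@continuous_slice2 (partial true u) s).
  + by rewrite u0//; apply: (NS _ _ _).2; rewrite sqrrN expr1n.
  + by rewrite u0//; apply: (NS _ _ _).2; rewrite expr1n.
- apply: (@has_integral_uniq _ mR R (@lebesgue_measure R) setT (fun=> 0));
    last exact: has_integral0.
  apply: (@Rfubini2 _ _ mR mR R (@lebesgue_measure R) (@lebesgue_measure R) _
    measurable_Scell _ ui setT (fun=> 0)) => //; first by apply: aeW => s /(_ I).
  apply: aeW => t _.
  rewrite Rintegral_mkcond; transitivity
     (\int[leb1]_(s in `[-1, 1]) partial false u (s, t)).
    rewrite [RHS]Rintegral_mkcond; congr (Rintegral _ _ _); apply/funext => s.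
    rewrite !patchE; case: ifPn => [|/negP]; rewrite mem_ysection inE => St.
      rewrite ifT// inE/= in_itv/= -ler_norml.
      by have [] := Scell_le1 St.
    by rewrite pu0// if_same.
  apply: (@FTC_vanishing (fun s => u (s, t))).
  + by move=> s; exact: is_derive_slice1.
  + exact: (@continuous_slice1 (partial false u) t).
  + by rewrite u0//; apply: (NS _ _ _).1; rewrite sqrrN expr1n.
  + by rewrite u0//; apply: (NS _ _ _).1; rewrite expr1n.
Qed.

Lemma test_disc_continuous (phi : R * R -> R) : test_disc phi -> continuous phi.
Proof. by move=> [sphi _ _] x; exact/differentiable_continuous/(sphi [::]). Qed.

Lemma test_disc_partial_continuous b (phi : R * R -> R) : test_disc phi ->
  continuous (partial b phi).
Proof. by move=> [sphi _ _] x; exact/differentiable_continuous/(sphi [:: b]). Qed.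

Lemma test_disc_eq0 (phi : R * R -> R) x : test_disc phi -> ~ Scell x -> phi x = 0.
Proof.
move=> [_ _ sS] Sx; apply: contra_notP Sx => /eqP phix.
by apply: sS; apply: subset_closure.
Qed.

Lemma test_disc_partial_eq0 b (phi : R * R -> R) x : test_disc phi ->
  ~ Scell x -> partial b phi x = 0.
Proof.
move=> [_ _ sS] Sx; rewrite /partial.
have oC : open (~` closure [set x | phi x != 0]).
  by apply: closed_openC; exact: closed_closure.
rewrite (@near_eq_derive _ _ _ _ (fun=> 0)) ?derive_cst//.
near=> y; apply/eqP; rewrite -[_ == _]negbK; apply/negP => phiy.
suff : ~ closure [set x | phi x != 0] y by apply; exact: subset_closure.
by near: y; apply: open_nbhs_nbhs; split => //; exact: contra_not (@sS x) Sx.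
Unshelve. all: by end_near. Qed.

Lemma elementary_continuous (f : R * R -> R) : elementary f -> continuous f.
Proof. by move=> ef x; exact/differentiable_continuous/differentiable_elementary. Qed.

(** The product [f * phi] vanishes outside the disc, so its partial derivatives integrate to zero;
    the product rule turns this into the weak formulation. *)
Lemma H1_disc_elementary (f : R * R -> R) : elementary f ->
  H1_disc f (partial false f) (partial true f).
Proof.
move=> ef; have cf := elementary_continuous ef.
have cpf b : continuous (partial b f).
  exact/elementary_continuous/elementary_partial.
split; try exact: continuous_L2_Scell.
suff H phi b : test_disc phi ->
    \int[leb2]_(x in Scell) (f x * partial b phi x) =
    - \int[leb2]_(x in Scell) (partial b f x * phi x) by split; exact: H.
move=> tphi; have cphi := test_disc_continuous tphi.
have cpphi := @test_disc_partial_continuous b phi tphi.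
have df x : differentiable f x := differentiable_elementary x ef.
have dphi x : differentiable phi x by case: tphi => + _ _ => /(_ [::]).
have E : partial b (fun x => f x * phi x) =
  (fun x => f x * partial b phi x + partial b f x * phi x).
  by rewrite partialM//; apply/funext => x; rewrite [phi x * _]mulrC.
have i1 := has_integral_integral (L2_mul_continuous_Scell (continuous_L2_Scell cf) cpphi).
have i2 := has_integral_integral (L2_mul_continuous_Scell (continuous_L2_Scell (cpf b)) cphi).
have := has_integralD measurable_Scell i1 i2.
have /has_integral_uniq /[apply] : has_integral leb2 Scell
   (fun x => f x * partial b phi x + partial b f x * phi x) 0.
  rewrite -E; apply: integral_partial_eq0.
  - by move=> x; exact: differentiableM.
  - move=> x; rewrite E.
    apply: (@continuousD _ _ _ (fun x => f x * partial b phi x)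
      (fun x => partial b f x * phi x)); apply: continuousM.
    + exact: cf.
    + exact: cpphi.
    + exact: cpf.
    + exact: cphi.
  - by move=> x Sx; rewrite (test_disc_eq0 tphi)// mulr0.
  - move=> x Sx; rewrite E (test_disc_eq0 tphi)// (@test_disc_partial_eq0 b phi x tphi)//.
    by rewrite !mulr0 addr0.
by move=> /esym/eqP; rewrite addr_eq0 => /eqP.
Qed.

Lemma H1_discD (f f2 f3 g g2 g3 : R * R -> R) :
  H1_disc f f2 f3 -> H1_disc g g2 g3 ->
  H1_disc (fun x => f x + g x) (fun x => f2 x + g2 x) (fun x => f3 x + g3 x).
Proof.
move=> [Lf Lf2 Lf3 Hf] [Lg Lg2 Lg3 Hg].
split; try (apply: L2D => //; exact: measurable_Scell).
have H (h k p : R * R -> R) : L2 leb2 Scell h -> L2 leb2 Scell k ->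
    continuous p -> \int[leb2]_(x in Scell) ((h x + k x) * p x) =
    \int[leb2]_(x in Scell) (h x * p x) + \int[leb2]_(x in Scell) (k x * p x).
  move=> Lh Lk cp; under eq_fun do rewrite mulrDl.
  rewrite RintegralD//; first exact: measurable_Scell.
    exact: L2_mul_continuous_Scell.
  exact: L2_mul_continuous_Scell.
move=> phi tphi; have cphi := test_disc_continuous tphi.
have cp b := @test_disc_partial_continuous b _ tphi.
have [Hf1 Hf2] := Hf _ tphi; have [Hg1 Hg2] := Hg _ tphi.
split; first by rewrite (H _ _ _ Lf Lg (cp _)) (H _ _ _ Lf2 Lg2 cphi) Hf1 Hg1 opprD.
by rewrite (H _ _ _ Lf Lg (cp _)) (H _ _ _ Lf3 Lg3 cphi) Hf2 Hg2 opprD.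
Qed.

(** Radial, and positive exactly where |x|^2 < 1 - 1/(n+1), so these discs exhaust the open unit
    disc. Only sums, products and constants are used, to match the constructors of [elementary]. *)
Definition cutoff_arg (n : nat) (x : R * R) : R :=
  n.+1%:R * (1 + -1 * (x.1 * x.1 + x.2 * x.2)) + -1.

Definition cutoff (n : nat) (x : R * R) : R := flat_exp 1 (cutoff_arg n x).

Lemma elementary_cutoff_arg n : elementary (cutoff_arg n).
Proof. by repeat constructor. Qed.

Lemma elementary_cutoff n : elementary (cutoff n).
Proof. by apply: elementary_flat_exp; exact: elementary_cutoff_arg. Qed.

Lemma partial_cutoff b n x : partial b (cutoff n) x =
  flat_exp ('X^2 * (1 - 1^`())) (cutoff_arg n x) *
  (- 2 * n.+1%:R * (if b then x.2 else x.1)).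
Proof.
rewrite partial_flat_exp; last first.
  by move=> y; apply/differentiable_elementary/elementary_cutoff_arg.
congr (_ * _); rewrite /cutoff_arg.
by rewrite !(partialD, partialM, partial_cst, partial_fst, partial_snd);
  try (move=> ?; apply: differentiable_elementary; by repeat constructor);
  case: b => /=; ring.
Qed.

(** The support lies in the closed set where [cutoff_arg n] is nonnegative, that is |x|^2 <= 1 -
    1/(n+1), which is contained in the open disc. *)
Lemma test_disc_cutoff n (q : R * R -> R) : elementary q ->
  test_disc (fun x => q x * cutoff n x).
Proof.
move=> eq; pose C : set (R * R) := [set x | 0 <= cutoff_arg n x].
have cC : closed C.
  apply: (@closed_comp _ _ (cutoff_arg n) [set t : R | 0 <= t]).
    by move=> x _; exact/elementary_continuous/elementary_cutoff_arg.
  exact: closed_ge.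
have sC : closure [set x | q x * cutoff n x != 0] `<=` C.
  rewrite [X in _ `<=` X](closure_id C).1//; apply: closure_subset => x /=; rewrite /C/=.
  by apply: contra_neqT; rewrite -ltNge => /ltW h; rewrite /cutoff flat_exp_le0// mulr0.
have CS : C `<=` Scell.
  move=> x; rewrite /C/Scell/= /cutoff_arg => h.
  have n0 : 0 < n.+1%:R :> R by rewrite ltr0n.
  by rewrite !expr2; nra.
split; last by apply: subset_trans CS.
  by apply: smooth2_elementary; apply: elementaryM => //; exact: elementary_cutoff.
apply: (@subclosed_compact _ _ (`[-1, 1]%classic `*` `[-1, 1]%classic : set (R * R))).
- exact: closed_closure.
- by apply: compact_setX; exact: segment_compact.
- by move=> x /sC/CS/Scell_box.
Qed.

(* The rotation field (x_3, - x_2) is tangent to the boundary circle, so that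
   integration by parts against it leaves no boundary term; radial cutoffs are
   annihilated by it. *)
Lemma torsion_integral (f g2 g3 : R * R -> R) : H1_disc f g2 g3 ->
  has_integral leb2 Scell (fun x => x.2 * g2 x - x.1 * g3 x) 0.
Proof.
move=> [Lf Lg2 Lg3 Hf].
have c1 : continuous (fun x : R * R => x.1).
  exact/elementary_continuous/elementary_fst.
have c2 : continuous (fun x : R * R => x.2).
  exact/elementary_continuous/elementary_snd.
pose w x := x.2 * g2 x - x.1 * g3 x.
have wi : leb2.-integrable Scell (EFin \o w).
  have := integrableB measurable_Scell (L2_mul_continuous_Scell Lg2 c2)
    (L2_mul_continuous_Scell Lg3 c1).
  by apply: eq_integrable => [|x _]; [exact: measurable_Scell|
    rewrite /w/= -EFinB mulrC [x.1 * _]mulrC].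
have ce n : continuous (cutoff n).
  exact/elementary_continuous/elementary_cutoff.
have w0 n : has_integral leb2 Scell (fun x => w x * cutoff n x) 0.
  have t1 := test_disc_cutoff n (@elementary_snd R).
  have t2 := test_disc_cutoff n (@elementary_fst R).
  have [H1 _] := Hf _ t1; have [_ H2] := Hf _ t2.
  (* The gradient of a radial function is parallel to x, so both sides are the same multiple of x.1
     * x.2. Hence the two integrals involving [f] cancel after integration by parts. *)
  have E : partial false (fun x => x.2 * cutoff n x) =
           partial true (fun x => x.1 * cutoff n x).
    rewrite !partialM.
    - apply/funext => x; rewrite !partial_cutoff partial_fst partial_snd/=.
      by ring.
    - by move=> x; exact/differentiable_elementary/elementary_fst.
    - by move=> x; exact/differentiable_elementary/elementary_cutoff.
    - by move=> x; exact/differentiable_elementary/elementary_snd.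
    - by move=> x; exact/differentiable_elementary/elementary_cutoff.
  have i1 := has_integral_integral
    (L2_mul_continuous_Scell Lg2 (test_disc_continuous t1)).
  have i2 := has_integral_integral
    (L2_mul_continuous_Scell Lg3 (test_disc_continuous t2)).
  apply: (eq_has_integral measurable_Scell) (has_integralB measurable_Scell i1 i2).
    by move=> x _; rewrite /w; ring.
  by apply/eqP; rewrite subr_eq0; apply/eqP/oppr_inj; rewrite -H1 -H2 E.
split=> //.
have wm : measurable_fun Scell (EFin \o w) by case/integrableP : wi.
(* The cutoffs take values in [0, 1] and tend to 1 at every point of the disc, so |w| dominates and
   the zero integrals pass to the limit. *)
have [||||//|_ _] := @dominated_convergence _ _ R leb2 Scell measurable_Scell
   (fun n x => (w x * cutoff n x)%:E) (EFin \o w) (fun x => `|w x|%:E).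
- by move=> n; apply/measurable_EFinP; exact: (has_integral_measurable (w0 n)).
- exact: wm.
- apply: aeW => x Sx; apply: cvg_EFin; first by apply: nearW.
  have a0 : 0 < 1 - (x.1 * x.1 + x.2 * x.2) by rewrite subr_gt0 -!expr2.
  have L : cutoff n x @[n --> \oo] --> (1 : R).
    have := cvg_flat_exp1 a0; rewrite -cvg_shiftS; apply: cvg_trans.
    apply: near_eq_cvg; apply: nearW => n /=.
    by rewrite /cutoff/cutoff_arg; congr (flat_exp _ _); ring.
  by have := cvgM (cvg_cst (w x)) L; rewrite mulr1; exact.
- exact: (integrable_norm wi).
- apply: aeW => x n Sx; rewrite lee_fin normrM ler_piMr//.
  have /andP[c0 cle1] := flat_exp1_bound (cutoff_arg n x).
  by rewrite ger0_norm.
move=> /(cvg_lim (@ereal_hausdorff _)) H.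
rewrite /Rintegral -H.
rewrite (_ : [sequence _]_n = cst 0%E) ?lim_cst//.
by apply/funext => n /=; rewrite (has_integralE measurable_Scell (w0 n)).
Qed.

End Plane.

(** * Relaxation fields *)

#[global] Instance leb1_ae_filter (R : realType) :
  Filter (nbhs (almost_everywhere (@leb1 R))).
Proof. exact: (ae_filter_ringOfSetsType (@leb1 R)). Qed.

#[global] Instance leb2_ae_filter (R : realType) :
  Filter (nbhs (almost_everywhere (@leb2 R))).
Proof. exact: (ae_filter_ringOfSetsType (@leb2 R)). Qed.

#[global] Instance leb3_ae_filter (R : realType) :
  Filter (nbhs (almost_everywhere (@leb3 R))).
Proof. exact: (ae_filter_ringOfSetsType (@leb3 R)). Qed.

Lemma colmat_first (R : realType) (v : 'cV[R]_3) (N : 'M[R]_(3, 2)) i :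
  colmat v N i 0 = v i 0.
Proof.
rewrite /colmat mxE; case: splitP => [j|j] /= h; last by [].
by rewrite (ord1 j).
Qed.

Lemma colmat_second (R : realType) (v : 'cV[R]_3) (N : 'M[R]_(3, 2)) i :
  colmat v N i 1 = N i 0.
Proof.
rewrite /colmat mxE; case: splitP => [j|j] /= h; first by case: j h => -[].
by congr (N _ _); apply/val_inj; case: h.
Qed.

Lemma colmat_third (R : realType) (v : 'cV[R]_3) (N : 'M[R]_(3, 2)) i :
  colmat v N i 2%:R = N i 1.
Proof.
rewrite /colmat mxE; case: splitP => [j|j] /= h; first by case: j h => -[].
by congr (N _ _); apply/val_inj; case: h.
Qed.

Lemma ord2P (j : 'I_2) : j = 0 \/ j = 1.
Proof. by case: j => -[|[|//]] h; [left|right]; exact: val_inj. Qed.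

Lemma ord3P (i : 'I_3) : [\/ i = 0, i = 1 | i = 2%:R].
Proof.
by case: i => -[|[|[|//]]] h; [apply: Or31|apply: Or32|apply: Or33];
  exact: val_inj.
Qed.

Lemma symE (R : realType) (A : 'M[R]_3) i j :
  sym A i j = 2^-1 * (A i j + A j i).
Proof. by rewrite !mxE. Qed.

Lemma symmetric3_sym (R : realType) (A : 'M[R]_3) : symmetric3 (sym A).
Proof. by apply/matrixP => i j; rewrite mxE !symE addrC. Qed.

Lemma symmetric3E (R : realType) (A : 'M[R]_3) i j : symmetric3 A -> A i j = A j i.
Proof. by move=> /(congr1 (fun M : 'M[R]_3 => M j i)); rewrite mxE. Qed.

Lemma skew3E (R : realType) (A : 'M[R]_3) i j : skew3 A -> A i j = - A j i.
Proof. by move=> /(congr1 (fun M : 'M[R]_3 => M j i)); rewrite !mxE. Qed.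

Lemma skew3_diag (R : realType) (A : 'M[R]_3) i : skew3 A -> A i i = 0.
Proof. by move=> /(skew3E i i); lra. Qed.

Lemma mulmx_xbold (R : realType) (K : 'M[R]_3) (x : R * R) i :
  (K *m xbold x) i 0 = K i 1 * x.1 + K i 2%:R * x.2.
Proof.
rewrite mxE !big_ord_recl big_ord0 !mxE /=.
rewrite (_ : lift ord0 ord0 = 1)//; last exact: val_inj.
by rewrite (_ : lift ord0 (lift ord0 ord0) = 2%:R) /=; [ring|exact: val_inj].
Qed.

Section SYdomain.
Context {R : realType}.
Local Notation mR := (measurableTypeR R).
Implicit Type f g : (R * R) * R -> R.

Lemma measurable_Ycell : measurable (@Ycell R : set mR).
Proof. exact: measurable_itv. Qed.

Lemma measurable_SY : measurable (@SY R : set ((mR * mR) * mR)).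
Proof. by apply: measurableX; [exact: measurable_Scell|exact: measurable_Ycell]. Qed.

Lemma leb1_Ycell : ((@leb1 R) Ycell = 1)%E.
Proof. by rewrite /leb1 /Ycell lebesgue_measure_itv/= lte_fin ltr01 sube0. Qed.

Lemma leb1_Ycell_fin : ((@leb1 R) Ycell < +oo)%E.
Proof. by rewrite leb1_Ycell ltry. Qed.

Lemma leb3_SY_fin : ((@leb3 R) SY < +oo)%E.
Proof.
have -> : (@leb3 R SY = (@leb2 R) Scell * (@leb1 R) Ycell)%E.
  apply: product_measure1E; [exact: measurable_Scell|exact: measurable_Ycell].
by rewrite leb1_Ycell mule1 leb2_Scell_fin.
Qed.

Lemma L2_ae f g : measurable_fun (SY : set ((mR * mR) * mR)) g ->
  {ae leb3, forall z, SY z -> f z = g z} -> L2 leb3 SY f -> L2 leb3 SY g.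
Proof.
move=> mg fg [mf fi]; split => //.
have : has_integral leb3 SY (fun z => g z ^+ 2) (\int[leb3]_(z in SY) (f z ^+ 2)).
  apply: (has_integral_ae measurable_SY _ _ (has_integral_integral fi)).
    exact: (measurable_funX 2 mg).
  by apply: filterS fg => z fg Sz; rewrite fg.
by case.
Qed.

Lemma measurable_SY_fst (q : R * R -> R) :
  measurable_fun (Scell : set (mR * mR)) (q : mR * mR -> R) ->
  measurable_fun (SY : set ((mR * mR) * mR)) (fun z : (mR * mR) * mR => q z.1).
Proof.
move=> mq; apply: (measurable_comp measurable_Scell) mq _.
  by move=> _ [z [Sz _] <-].
by apply: measurable_funTS; exact: measurable_fst.
Qed.

Lemma measurable_SY_snd (q : R -> R) : measurable_fun (Ycell : set mR) q ->
  measurable_fun (SY : set ((mR * mR) * mR)) (fun z : (mR * mR) * mR => q z.2).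
Proof.
move=> mq; apply: (measurable_comp measurable_Ycell) mq _.
  by move=> _ [z [_ Yz] <-].
by apply: measurable_funTS; exact: measurable_snd.
Qed.

Lemma continuous_SY_L2 (q : R * R -> R) : continuous q ->
  L2 leb3 SY (fun z => q z.1).
Proof.
move=> cq; have [c qc] := continuous_bounded_Scell cq.
apply: (@L2_bounded _ _ _ _ _ measurable_SY leb3_SY_fin _ c).
  by apply: (@measurable_SY_fst q); exact: measurable_continuous_prod.
by move=> z [Sz _]; exact: qc.
Qed.

Lemma L2_mul_continuous_SY f (q : R * R -> R) : L2 leb3 SY f -> continuous q ->
  L2 leb3 SY (fun z => q z.1 * f z).
Proof.
move=> f2 cq; have [c qc] := continuous_bounded_Scell cq.
under eq_fun do rewrite mulrC.
apply: (L2_mul_bounded measurable_SY (c := c)) => //.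
  by apply: (@measurable_SY_fst q); exact: measurable_continuous_prod.
by move=> z [Sz _]; exact: qc.
Qed.

Lemma SY_fubini1 f : leb3.-integrable SY (EFin \o f) ->
  {ae leb2, forall x, Scell x -> \int[leb1]_(y in Ycell) f (x, y) = 0} ->
  has_integral leb3 SY f 0.
Proof.
move=> fi f0; split => //.
apply: (@has_integral_uniq _ _ R leb2 Scell (fun=> 0)); last exact: has_integral0.
apply: (@Rfubini1 _ _ _ _ R leb2 (@lebesgue_measure R) _ measurable_SY _ fi) => //.
- exact: measurable_Scell.
- by apply: aeW => x Sx; rewrite /SY xsectionE /=; apply/seteqP; split => // y [].
- apply: filterS f0 => x /[swap] Sx /(_ Sx) <-; congr (Rintegral _ _ _).
  by rewrite /SY xsectionE; apply/seteqP; split => [y []|y Yy].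
Qed.

Lemma SY_fubini2 f (g : R -> R) : leb3.-integrable SY (EFin \o f) ->
  measurable_fun (Ycell : set mR) g ->
  {ae leb1, forall y, Ycell y -> \int[leb2]_(x in Scell) f (x, y) = g y} ->
  has_integral leb3 SY f (\int[leb1]_(y in Ycell) g y).
Proof.
move=> fi mg f0; split => //.
apply: (@has_integral_uniq _ _ R leb1 Ycell g); last first.
  apply: has_integral_integral.
  have [] // := (@Rfubini2 _ _ _ _ R leb2 (@lebesgue_measure R) _ measurable_SY _ fi
    Ycell g measurable_Ycell mg).
  - by apply: aeW => x Sx; rewrite /SY ysectionE /=; apply/seteqP; split => // y [].
  - apply: filterS f0 => x /[swap] Sx /(_ Sx) <-; congr (Rintegral _ _ _).
    by rewrite /SY ysectionE; apply/seteqP; split => [y []|y Yy].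
apply: (@Rfubini2 _ _ _ _ R leb2 (@lebesgue_measure R) _ measurable_SY _ fi) => //.
- exact: measurable_Ycell.
- by apply: aeW => x Sx; rewrite /SY ysectionE /=; apply/seteqP; split => // y [].
- apply: filterS f0 => x /[swap] Sx /(_ Sx) <-; congr (Rintegral _ _ _).
  by rewrite /SY ysectionE; apply/seteqP; split => [y []|y Yy].
Qed.

End SYdomain.

Section Relaxation.
Context {R : realType}.
Local Notation mR := (measurableTypeR R).
Implicit Type chi : tfield R.

(* What the two regimes have in common: the first column is a [y]-derivative,
   and the remaining ones are a cross-sectional gradient. *)
Record relaxation chi (v : (R * R) * R -> 'cV[R]_3)
    (N : (R * R) * R -> 'M[R]_(3, 2)) : Prop := Relaxation {
  relaxation_Hspace : Hspace chi ;
  relaxation_ae : ae_eq_SY chi (fun z => sym (colmat (v z) (N z))) ;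
  relaxation_L2v : L2mx leb3 SY v ;
  relaxation_L2N : forall j, L2 leb3 SY (fun z => N z 0 j) ;
  relaxation_v : {ae leb2, forall x, Scell x -> forall i,
    has_integral leb1 Ycell (fun y => v (x, y) i 0) 0} ;
  relaxation_N : {ae leb1, forall y, Ycell y ->
    \int[leb2]_(x in Scell) (x.2 * N (x, y) 0 0 - x.1 * N (x, y) 0 1) = 0} }.

(** The constant 1 is a test function on the torus, and its derivative is zero. *)
Lemma H1_torus_integral (f f' : R -> R) : H1_torus f f' ->
  has_integral leb1 Ycell f' 0.
Proof.
move=> [f2 f'2 Hf]; split.
  exact: (L2_integrable measurable_Ycell leb1_Ycell_fin f'2).
have t1 : test_torus (fun _ : R => 1 : R).
  split => // n y; rewrite (_ : derive1n n _ = (cst (n == 0%N)%:R : R -> R)).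
    exact: derivable_cst.
  elim: n => [|n IH]; first by [].
  by rewrite derive1nS IH; apply/funext => z; rewrite derive1_cst.
have := Hf _ t1; under eq_Rintegral do rewrite derive1_cst mulr0.
under [X in _ = - X -> _]eq_Rintegral do rewrite mulr1.
by rewrite (@has_integral0 _ mR R leb1 Ycell).2 => /esym/eqP; rewrite oppr_eq0 => /eqP.
Qed.

(** Square integrability on S x Y is assumed of only one of the two blocks: the gradient in the
    regime 0, the first column in the regime infinity. The other block is recovered from [chi],
    itself in H, by identities such as 2 chi_01 = v_1 + N_00. *)
Lemma Hrel_relaxation gamma chi : Hrel gamma chi ->
  exists v N, relaxation chi v N.
Proof.
case: gamma => -[Hchi].
- move=> [Psi [dPsi [phih [dphih [phib [N [HPsi _ Hphih [_ N2 HN] chiE]]]]]]].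
  pose v z := dPsi z.2 *m xbold z.1 + dphih z.2.
  have mv i : measurable_fun (SY : set ((mR * mR) * mR)) (fun z => v z i 0).
    under eq_fun do rewrite mxE mulmx_xbold.
    have mPsi j : measurable_fun (SY : set ((mR * mR) * mR))
        (fun z : (mR * mR) * mR => dPsi z.2 i j).
      by apply: (@measurable_SY_snd _ (fun y => dPsi y i j)); case: (HPsi i j) => _ [].
    apply: measurable_funD; last first.
      by apply: (@measurable_SY_snd _ (fun y => dphih y i 0)); case: (Hphih i 0) => _ [].
    apply: measurable_funD; apply: measurable_funM => //.
      by apply: (@measurable_SY_fst _ (fun x => x.1)); apply: measurable_funTS; exact: measurable_fst.
    by apply: (@measurable_SY_fst _ (fun x => x.2)); apply: measurable_funTS; exact: measurable_snd.
  exists v, N; split => //.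
  + move=> i j; rewrite (ord1 j){j}.
    have [L1 L2'] := Hchi.
    have [->|->|->] := ord3P i.
    * apply: (L2_ae (mv 0) _ (L1 0 0)); apply: filterS chiE => z h Sz.
      rewrite (h Sz) symE !colmat_first -/(v z); lra.
    * have := L2B measurable_SY (L2Z measurable_SY 2 (L1 0 1)) (N2 0 0).
      apply: L2_ae => //; apply: filterS chiE => z h Sz.
      rewrite (h Sz) symE colmat_first colmat_second -/(v z); lra.
    * have := L2B measurable_SY (L2Z measurable_SY 2 (L1 0 2%:R)) (N2 0 1).
      apply: L2_ae => //; apply: filterS chiE => z h Sz.
      rewrite (h Sz) symE colmat_first colmat_third -/(v z); lra.
  + apply: aeW => x Sx i.
    have iPsi j := H1_torus_integral (HPsi i j).
    have ih := H1_torus_integral (Hphih i 0).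
    have := has_integralD measurable_Ycell (has_integralD measurable_Ycell
      (has_integralZ measurable_Ycell x.1 (iPsi 1))
      (has_integralZ measurable_Ycell x.2 (iPsi 2%:R))) ih.
    apply: (eq_has_integral measurable_Ycell); last by ring.
    by move=> y _; rewrite /v mxE mulmx_xbold; ring.
  + by apply: filterS HN => y h Yy; have [_] := torsion_integral (h Yy 0).
- move=> [v [dv [phib [N [[_ v2 Hv] HN chiE]]]]].
  exists dv, (fun z => N z.1); split => //.
  + have NS j : measurable_fun (SY : set ((mR * mR) * mR)) (fun z => N z.1 0 j).
      apply: (@measurable_SY_fst _ (fun x => N x 0 j)).
      have [_ [m2 _] [m3 _] _] := HN 0.
      by case: j => -[|[|//]] h; [move: m2|move: m3]; congr (measurable_fun _ _);
         apply/funext => x; congr (N _ _ _); exact: val_inj.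
    have [L1 L2'] := Hchi.
    move=> j.
    have [->|->] := ord2P j.
    * have := L2B measurable_SY (L2Z measurable_SY 2 (L1 0 1)) (v2 1 0).
      apply: L2_ae => //; apply: filterS chiE => z h Sz.
      rewrite (h Sz) symE colmat_first colmat_second; lra.
    * have := L2B measurable_SY (L2Z measurable_SY 2 (L1 0 2%:R)) (v2 2%:R 0).
      apply: L2_ae => //; apply: filterS chiE => z h Sz.
      rewrite (h Sz) symE colmat_first colmat_third; lra.
  + apply: filterS Hv => x h Sx i.
    exact: H1_torus_integral (h Sx i 0).
  + by apply: aeW => y Yy; have [_] := torsion_integral (HN 0).
Qed.

Section Pairings.
Variables (chi : tfield R) (v : (R * R) * R -> 'cV[R]_3)
  (N : (R * R) * R -> 'M[R]_(3, 2)).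
Hypothesis chivN : relaxation chi v N.

(** The weight [q] does not depend on y and [chi 0 0] is the first entry of [v], so integrating in y
    first gives zero on almost every fibre. *)
Lemma relaxation_axial (q : R * R -> R) : continuous q ->
  has_integral leb3 SY (fun z => q z.1 * chi z 0 0) 0.
Proof.
move=> cq; case: chivN => -[Lchi _] chiE Lv LN Hv _.
have Lqv := L2_mul_continuous_SY (Lv 0 0) cq.
have : has_integral leb3 SY (fun z => q z.1 * v z 0 0) 0.
  apply: SY_fubini1; first exact: (L2_integrable measurable_SY leb3_SY_fin Lqv).
  apply: filterS Hv => x h Sx.
  by have [_] := has_integralZ measurable_Ycell (q x) (h Sx 0); rewrite mulr0.
apply: (has_integral_ae measurable_SY).
  by case: (L2_mul_continuous_SY (Lchi 0 0) cq).
apply: filterS chiE => z h Sz; rewrite (h Sz) symE !colmat_first; lra.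
Qed.

(** The off-diagonal entries are half sums of two terms that vanish in opposite orders of
    integration: the [v] term after integrating in y first, the gradient term after integrating over
    the disc first. *)
Lemma relaxation_torsion : has_integral leb3 SY
  (fun z => z.1.2 * chi z 0 1 - z.1.1 * chi z 0 2%:R) 0.
Proof.
have c1 : continuous (fun x : R * R => x.1).
  exact/elementary_continuous/elementary_fst.
have c2 : continuous (fun x : R * R => x.2).
  exact/elementary_continuous/elementary_snd.
case: chivN => -[Lchi _] chiE Lv LN Hv HN.
have L2i f : L2 leb3 SY f -> leb3.-integrable SY (EFin \o f).
  exact: (L2_integrable measurable_SY leb3_SY_fin).
have V : has_integral leb3 SY (fun z => z.1.2 * v z 1 0 - z.1.1 * v z 2%:R 0) 0.
  apply: SY_fubini1.
    apply/L2i/(L2B measurable_SY).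
      exact: (L2_mul_continuous_SY (Lv 1 0) c2).
    exact: (L2_mul_continuous_SY (Lv 2%:R 0) c1).
  apply: filterS Hv => x h Sx.
  have [_] := has_integralB measurable_Ycell
    (has_integralZ measurable_Ycell x.2 (h Sx 1))
    (has_integralZ measurable_Ycell x.1 (h Sx 2%:R)).
  by rewrite !mulr0 subr0.
have W : has_integral leb3 SY (fun z => z.1.2 * N z 0 0 - z.1.1 * N z 0 1) 0.
  rewrite -[X in has_integral _ _ _ X](@has_integral0 _ mR R leb1 Ycell).2.
  apply: (@SY_fubini2 _ _ (fun=> 0)) => //.
  apply/L2i/(L2B measurable_SY).
    exact: (L2_mul_continuous_SY (LN 0) c2).
  exact: (L2_mul_continuous_SY (LN 1) c1).
have := has_integralZ measurable_SY 2^-1 (has_integralD measurable_SY V W).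
rewrite addr0 mulr0; apply: (has_integral_ae measurable_SY).
  apply: measurable_funB.
    by case: (L2_mul_continuous_SY (Lchi 0 1) c2).
  by case: (L2_mul_continuous_SY (Lchi 0 2%:R) c1).
apply: filterS chiE => z h Sz.
by rewrite (h Sz) !symE !colmat_first !colmat_second !colmat_third; ring.
Qed.

End Pairings.

End Relaxation.

(** * Lateral contraction as an element of the relaxation space *)

Section PlaneCorrector.
Context {R : realType}.
Variables (nu k2 k3 a : R).

Definition axial (x : R * R) : R := k2 * x.1 + k3 * x.2 + a.

(** With z = x.1 + i x.2, the pair (phi1, phi2) is the holomorphic function - nu (a z + (k2 - i k3)
    z^2 / 2). By the Cauchy-Riemann equations its symmetrized gradient is a multiple of the
    identity, namely the real part - nu (k2 x.1 + k3 x.2 + a) of its derivative. *)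
Let phi1 (x : R * R) : R :=
  - nu * (a * x.1 + (k2 / 2 * (x.1 * x.1 + -1 * (x.2 * x.2)) + k3 * (x.1 * x.2))).
Let phi2 (x : R * R) : R :=
  - nu * (a * x.2 + (k2 * (x.1 * x.2) + k3 / 2 * (x.2 * x.2 + -1 * (x.1 * x.1)))).

Definition corrector_disp (x : R * R) : 'cV[R]_3 :=
  \col_i (if i == 1 then phi1 x else if i == 2%:R then phi2 x else 0).

Definition corrector_grad (x : R * R) : 'M[R]_(3, 2) :=
  \matrix_(i, j) (if i == 1
    then (if j == 0 then - nu * axial x else - nu * (k3 * x.1 + - k2 * x.2))
    else if i == 2%:R
    then (if j == 0 then - nu * (k2 * x.2 + - k3 * x.1) else - nu * axial x)
    else 0).

(* The lateral contraction [- nu * axial] is affine, hence a compatible plane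
   strain: it is the symmetrized gradient of a quadratic displacement. *)
Definition corrector (x : R * R) : 'M[R]_3 := sym (colmat 0 (corrector_grad x)).

Lemma correctorE x i j :
  corrector x i j = if (i == j) && (i != 0) then - nu * axial x else 0.
Proof.
rewrite /corrector symE.
have [->|->|->] := ord3P i; have [->|->|->] := ord3P j;
  rewrite ?colmat_first ?colmat_second ?colmat_third !mxE /=; lra.
Qed.

Lemma corrector_H1 : H1_disc_cV corrector_disp corrector_grad.
Proof.
have ephi1 : elementary phi1 by repeat constructor.
have ephi2 : elementary phi2 by repeat constructor.
have D (f : R * R -> R) : elementary f -> forall x, differentiable f x.
  by move=> ef x; exact: differentiable_elementary.
move=> i; have [->|->|->] := ord3P i.
- under eq_fun do rewrite mxE/=.
  under [X in H1_disc _ X]eq_fun do rewrite mxE/=.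
  under [X in H1_disc _ _ X]eq_fun do rewrite mxE/=.
  have := H1_disc_elementary (@elementary_cst R 0).
  by rewrite !partial_cst.
- have := H1_disc_elementary ephi1.
  have -> : partial false phi1 = fun x => corrector_grad x 1 0.
    apply/funext => x; rewrite mxE/= /phi1 /axial.
    by rewrite !(partialD, partialM, partial_cst, partial_fst, partial_snd);
      try (by apply: D; repeat constructor); rewrite /=; field.
  have -> : partial true phi1 = fun x => corrector_grad x 1 1.
    apply/funext => x; rewrite mxE/= /phi1 /axial.
    by rewrite !(partialD, partialM, partial_cst, partial_fst, partial_snd);
      try (by apply: D; repeat constructor); rewrite /=; field.
  by congr H1_disc; apply/funext => x; rewrite mxE.
- have := H1_disc_elementary ephi2.
  have -> : partial false phi2 = fun x => corrector_grad x 2%:R 0.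
    apply/funext => x; rewrite mxE/= /phi2 /axial.
    by rewrite !(partialD, partialM, partial_cst, partial_fst, partial_snd);
      try (by apply: D; repeat constructor); rewrite /=; field.
  have -> : partial true phi2 = fun x => corrector_grad x 2%:R 1.
    apply/funext => x; rewrite mxE/= /phi2 /axial.
    by rewrite !(partialD, partialM, partial_cst, partial_fst, partial_snd);
      try (by apply: D; repeat constructor); rewrite /=; field.
  by congr H1_disc; apply/funext => x; rewrite mxE.
Qed.

Lemma continuous_axial : continuous axial.
Proof. by apply: elementary_continuous; repeat constructor. Qed.

Lemma corrector_Hspace : Hspace (fun z : (R * R) * R => corrector z.1).
Proof.
split; last by apply: aeW => z _; exact: symmetric3_sym.
move=> i j; under eq_fun do rewrite correctorE.
case: ((i == j) && (i != 0)); last first.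
  by apply: (@continuous_SY_L2 _ (fun=> 0)) => x; exact: cvg_cst.
by apply: (@continuous_SY_L2 _ (fun x => - nu * axial x));
   apply: elementary_continuous; repeat constructor.
Qed.

Lemma HspaceD (F G : tfield R) : Hspace F -> Hspace G ->
  Hspace (fun z => F z + G z).
Proof.
move=> [LF sF] [LG sG]; split.
  by move=> i j; under eq_fun do rewrite mxE; exact: (L2D measurable_SY).
apply: filterS2 sF sG => z sF sG Sz.
by rewrite /symmetric3 linearD /= (sF Sz) (sG Sz).
Qed.

Lemma sym_colmatD_corrector (v : 'cV[R]_3) (N : 'M[R]_(3, 2)) x :
  sym (colmat v N) + corrector x = sym (colmat v (N + corrector_grad x)).
Proof.
apply/matrixP => i j; rewrite mxE !symE.
by have [->|->|->] := ord3P i; have [->|->|->] := ord3P j;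
  rewrite !(colmat_first, colmat_second, colmat_third) ?mxE /= ?mxE; ring.
Qed.

Lemma elementary_corrector_disp i : elementary (fun x => corrector_disp x i 0).
Proof.
under eq_fun do rewrite mxE.
case: (i == 1); first by repeat constructor.
by case: (i == 2%:R); repeat constructor.
Qed.

Lemma elementary_corrector_grad i j :
  elementary (fun x => corrector_grad x i j).
Proof.
under eq_fun do rewrite mxE.
case: (i == 1); first by case: (j == 0); repeat constructor.
case: (i == 2%:R); last by repeat constructor.
by case: (j == 0); repeat constructor.
Qed.

Lemma H1_disc_cVD_corrector (f : R * R -> 'cV[R]_3) (N : R * R -> 'M[R]_(3, 2)) :
  H1_disc_cV f N -> H1_disc_cV (fun x => f x + corrector_disp x)
    (fun x => N x + corrector_grad x).
Proof.
move=> H i; have := H1_discD (H i) (corrector_H1 i).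
by congr H1_disc; apply/funext => x; rewrite [RHS]mxE.
Qed.

(** The corrector is independent of y and contributes nothing to the first column, so in either
    regime it is absorbed by the cross-sectional displacement alone. *)
Lemma HrelD_corrector gamma (chi : tfield R) : Hrel gamma chi ->
  Hrel gamma (fun z => chi z + corrector z.1).
Proof.
case: gamma => -[Hchi].
- move=> [Psi [dPsi [phih [dphih [phib [N [HPsi sPsi Hphih [f2 N2 HN] chiE]]]]]]].
  split; first exact: (HspaceD Hchi corrector_Hspace).
  exists Psi, dPsi, phih, dphih, (fun z => phib z + corrector_disp z.1),
    (fun z => N z + corrector_grad z.1); split => //.
    split.
    + move=> i j; rewrite (ord1 j); under eq_fun do rewrite mxE.
      apply: (L2D measurable_SY) => //.
      apply: (@continuous_SY_L2 _ (fun x => corrector_disp x i 0)).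
      exact/elementary_continuous/elementary_corrector_disp.
    + move=> i j; under eq_fun do rewrite mxE.
      apply: (L2D measurable_SY) => //.
      apply: (@continuous_SY_L2 _ (fun x => corrector_grad x i j)).
      exact/elementary_continuous/elementary_corrector_grad.
    + apply: filterS HN => y h Yy; exact: H1_disc_cVD_corrector (h Yy).
  by apply: filterS chiE => z h Sz; rewrite (h Sz) sym_colmatD_corrector.
- move=> [v [dv [phib [N [Hv HN chiE]]]]].
  split; first exact: (HspaceD Hchi corrector_Hspace).
  exists v, dv, (fun x => phib x + corrector_disp x),
    (fun x => N x + corrector_grad x); split => //.
    exact: H1_disc_cVD_corrector.
  by apply: filterS chiE => z h Sz; rewrite (h Sz) sym_colmatD_corrector.
Qed.

End PlaneCorrector.

Lemma L2mx0 {R : realType} d (T : measurableType d)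
  (m : {measure set T -> \bar R}) (D : set T) p q :
  L2mx m D (fun=> 0 : 'M[R]_(p, q)).
Proof.
move=> i j; under eq_fun do rewrite mxE; split => //.
by under eq_fun do rewrite expr0n; exact: integrable0.
Qed.

Lemma H1_torus0 {R : realType} : H1_torus (fun=> 0 : R) (fun=> 0).
Proof.
have L : L2 leb1 (@Ycell R) (fun=> 0 : R).
  have := @L2mx0 R _ _ leb1 Ycell 1 1 0 0.
  by under eq_fun do rewrite mxE.
split=> // phi _.
under eq_Rintegral do rewrite mul0r.
under [X in _ = - X]eq_Rintegral do rewrite mul0r.
have [_ ->] := @has_integral0 _ (measurableTypeR R) R leb1 Ycell.
by rewrite oppr0.
Qed.

Lemma Hrel_zero (R : realType) gamma : Hrel gamma (fun=> 0 : 'M[R]_3).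
Proof.
have S0 : sym (colmat 0 0) = 0 :> 'M[R]_3.
  by rewrite /colmat row_mx0 /sym trmx0 addr0 scaler0.
have H0 : Hspace (fun=> 0 : 'M[R]_3).
  split; first exact: (@L2mx0 R _ _ leb3).
  by apply: aeW => z _; rewrite /symmetric3 trmx0.
have T0 p q : H1_torus_mx (fun=> 0 : 'M[R]_(p, q)) (fun=> 0).
  move=> i j; under eq_fun do rewrite mxE.
  exact: H1_torus0.
have D0 : H1_disc_cV (fun=> 0 : 'cV[R]_3) (fun=> 0).
  move=> i; have := H1_disc_elementary (@elementary_cst R 0).
  by rewrite !partial_cst; congr H1_disc; apply/funext => x; rewrite mxE.
case: gamma; split => //.
- exists (fun=> 0), (fun=> 0), (fun=> 0), (fun=> 0), (fun=> 0), (fun=> 0); split.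
  + exact: T0.
  + by apply: aeW => y _; rewrite /skew3 trmx0 oppr0.
  + exact: T0.
  + split; [exact: (@L2mx0 R _ _ leb3)|exact: (@L2mx0 R _ _ leb3)|].
    by apply: aeW => y _; exact: D0.
  + by apply: aeW => z _; rewrite mul0mx addr0 S0.
- exists (fun=> 0), (fun=> 0), (fun=> 0), (fun=> 0); split.
  + split; [exact: (@L2mx0 R _ _ leb3)|exact: (@L2mx0 R _ _ leb3)|].
    by apply: aeW => y _; exact: T0.
  + exact: D0.
  + by apply: aeW => z _; rewrite S0.
Qed.

(** * Elastic energy and projection *)

Section Energy.
Context {R : realType}.
Variables mu la : R.
Implicit Types (F G A B C : 'M[R]_3).

Lemma sum_ord3 (f : 'I_3 -> R) : \sum_i f i = f 0 + f 1 + f 2%:R.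
Proof.
rewrite !big_ord_recl big_ord0 addr0 addrA; congr (f _ + f _ + f _); exact: val_inj.
Qed.

Lemma QE G : Q mu la G =
  2 * mu * \sum_i \sum_j sym G i j ^+ 2 + la * \tr G ^+ 2.
Proof.
rewrite /Q /fnorm sqr_sqrtr//.
by apply: sumr_ge0 => i _; apply: sumr_ge0 => j _; exact: sqr_ge0.
Qed.

Lemma LLE F G : LL mu la F G =
  2 * mu * (\sum_i \sum_j sym F i j * sym G i j) + la * \tr F * \tr G.
Proof.
by rewrite /LL !QE /mxtrace !sum_ord3 !symE !mxE; field.
Qed.

Lemma LLC F G : LL mu la F G = LL mu la G F.
Proof. by rewrite !LLE /mxtrace !sum_ord3; ring. Qed.

Lemma LLDl A B C : LL mu la (A + B) C = LL mu la A C + LL mu la B C.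
Proof. by rewrite !LLE /mxtrace !sum_ord3 !symE !mxE; ring. Qed.

Lemma LLBl A B C : LL mu la (A - B) C = LL mu la A C - LL mu la B C.
Proof. by rewrite !LLE /mxtrace !sum_ord3 !symE !mxE; ring. Qed.

Lemma LL_integrable (F G : tfield R) : L2mx leb3 SY F -> L2mx leb3 SY G ->
  leb3.-integrable SY (EFin \o (fun z => LL mu la (F z) (G z))).
Proof.
move=> LF LG.
have Ls (H : tfield R) i j : L2mx leb3 SY H -> L2 leb3 SY (fun z => sym (H z) i j).
  move=> LH; under eq_fun do rewrite symE.
  exact: (L2Z measurable_SY _ (L2D measurable_SY (LH i j) (LH j i))).
have Lt (H : tfield R) : L2mx leb3 SY H -> L2 leb3 SY (fun z => \tr (H z)).
  move=> LH; under eq_fun do rewrite /mxtrace sum_ord3.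
  by apply: (L2D measurable_SY); [apply: (L2D measurable_SY)|]; exact: LH.
have int (f g : (R * R) * R -> R) : L2 leb3 SY f -> L2 leb3 SY g ->
    has_integral leb3 SY (fun z => f z * g z) (\int[leb3]_(z in SY) (f z * g z)).
  by move=> Lf Lg; apply: has_integral_integral; exact: (L2_sqr_integrable measurable_SY).
have sumint := has_integral_sum measurable_SY (index_enum 'I_3)
  (fun i => has_integral_sum measurable_SY (index_enum 'I_3)
    (fun j => int _ _ (Ls F i j LF) (Ls G i j LG))).
have := has_integralD measurable_SY (has_integralZ measurable_SY (2 * mu) sumint)
  (has_integralZ measurable_SY la (int _ _ (Lt F LF) (Lt G LG))).
by under eq_fun do rewrite mulrA -LLE; case.
Qed.

Lemma inner_has_integral (F G : tfield R) : L2mx leb3 SY F -> L2mx leb3 SY G ->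
  has_integral leb3 SY (fun z => LL mu la (F z) (G z)) (inner mu la F G).
Proof. by move=> LF LG; apply: has_integral_integral; exact: LL_integrable. Qed.

Lemma inner_ae (F G H : tfield R) : L2mx leb3 SY F -> L2mx leb3 SY G ->
  L2mx leb3 SY H -> ae_eq_SY G H -> inner mu la F G = inner mu la F H.
Proof.
move=> LF LG LH GH.
apply: (has_integral_uniq (mu := leb3)) (inner_has_integral LF LH).
apply: (has_integral_ae measurable_SY) (inner_has_integral LF LG).
  exact: (has_integral_measurable (inner_has_integral LF LH)).
by apply: filterS GH => z h Sz; rewrite (h Sz).
Qed.

Lemma innerC (F G : tfield R) : inner mu la F G = inner mu la G F.
Proof. by apply: eq_Rintegral => z _; exact: LLC. Qed.

Lemma innerBl (F G H : tfield R) : L2mx leb3 SY F -> L2mx leb3 SY G ->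
  L2mx leb3 SY H ->
  inner mu la (fun z => F z - G z) H = inner mu la F H - inner mu la G H.
Proof.
move=> LF LG LH; apply: (has_integral_uniq (mu := leb3)) (has_integralB measurable_SY
  (inner_has_integral LF LH) (inner_has_integral LG LH)).
under [X in has_integral _ _ X]eq_fun do rewrite -LLBl.
apply: inner_has_integral => // i j; under eq_fun do rewrite mxE [X in _ + X]mxE.
exact: (L2B measurable_SY).
Qed.

Hypotheses (mu_gt0 : 0 < mu) (la_ge0 : 0 <= la).

Lemma LL_ge0 G : 0 <= LL mu la G G.
Proof.
rewrite LLE addr_ge0//.
  apply: mulr_ge0; first by rewrite mulr_ge0// ltW.
  apply: sumr_ge0 => i _; apply: sumr_ge0 => j _.
  by rewrite -expr2 sqr_ge0.
by rewrite -mulrA mulr_ge0// -expr2 sqr_ge0.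
Qed.

(** The trace term is nonnegative and mu > 0, so every squared entry of [sym G] vanishes; symmetry
    is what turns this into a statement on [G]. *)
Lemma LL_eq0 G : symmetric3 G -> LL mu la G G = 0 -> G = 0.
Proof.
move=> sG; rewrite LLE => h.
have tr0 : 0 <= la * \tr G * \tr G by rewrite -mulrA mulr_ge0// -expr2 sqr_ge0.
have sqr0 i j : 0 <= sym G i j * sym G i j by rewrite -expr2 sqr_ge0.
have s0 : \sum_i \sum_j sym G i j * sym G i j = 0.
  apply/eqP; rewrite eq_le; apply/andP; split.
    by rewrite -(pmulr_rle0 _ (_ : 0 < 2 * mu)) ?mulr_gt0//; lra.
  by apply: sumr_ge0 => i _; exact: sumr_ge0.
apply/matrixP => i j; rewrite mxE.
have -> : G i j = sym G i j by rewrite symE (symmetric3E j i sG); lra.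
have /psumr_eq0P/(_ i isT) := s0.
move=> /(_ (fun i _ => sumr_ge0 _ (fun j _ => sqr0 i j))).
by move/psumr_eq0P => /(_ (fun j _ => sqr0 i j) j isT)/eqP; rewrite mulf_eq0 orbb => /eqP.
Qed.

Definition poisson_ratio : R := la / (2 * (la + mu)).
Definition young_modulus : R := mu * (3 * la + 2 * mu) / (la + mu).

Lemma young_modulus_gt0 : 0 < young_modulus.
Proof.
by rewrite divr_gt0 ?mulr_gt0 ?ltr_wpDl ?mulr_ge0 ?mulr_gt0.
Qed.

Lemma EEE (K : 'M[R]_3) (a : R) z : skew3 K -> forall i j, EE K a z i j =
  if (i == 0) && (j == 0) then axial (K 0 1) (K 0 2%:R) a z.1
  else if (i == 0) && (j == 1) || (i == 1) && (j == 0) then K 1 2%:R * z.1.2 / 2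
  else if (i == 0) && (j == 2%:R) || (i == 2%:R) && (j == 0)
    then - K 1 2%:R * z.1.1 / 2
  else 0.
Proof.
move=> sK i j; rewrite /EE symE.
have T k l : tensor (K *m xbold z.1 + a *: e_ 0) (e_ 0) k l =
    (K k 1 * z.1.1 + K k 2%:R * z.1.2 + a * (k == 0)%:R) * (l == 0)%:R.
  by rewrite /tensor mxE big_ord1 [X in X * _]mxE mulmx_xbold !mxE !andbT.
rewrite !T /axial.
have K11 := skew3_diag 1 sK; have K22 := skew3_diag 2%:R sK.
have K21 := skew3E 2%:R 1 sK.
by have [->|->|->] := ord3P i; have [->|->|->] := ord3P j => /=;
  rewrite ?K11 ?K22 ?K21; field.
Qed.

(* Representative of the projection of [EE K a]: its stress is uniaxial up to
   torsion. *)
Definition relaxed (K : 'M[R]_3) (a : R) : tfield R :=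
  fun z => EE K a z + corrector poisson_ratio (K 0 1) (K 0 2%:R) a z.1.

Lemma relaxedE K a z i j : relaxed K a z i j =
  EE K a z i j + corrector poisson_ratio (K 0 1) (K 0 2%:R) a z.1 i j.
Proof. by rewrite /relaxed [LHS]mxE. Qed.

(** Poisson's ratio is chosen so that the lateral normal stress, axial times - 2 mu nu + la (1 - 2
    nu), is zero. The axial stress coefficient 2 mu + la (1 - 2 nu) is then Young's modulus, and
    only the first row of [G] is seen. *)
Lemma LL_relaxed K a z G : skew3 K -> symmetric3 G ->
  LL mu la (relaxed K a z) G =
  young_modulus * axial (K 0 1) (K 0 2%:R) a z.1 * G 0 0 +
  2 * mu * K 1 2%:R * (z.1.2 * G 0 1 - z.1.1 * G 0 2%:R).
Proof.
move=> sK sG; rewrite LLE /mxtrace !sum_ord3 !symE.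
rewrite (symmetric3E 1 0 sG) (symmetric3E 2%:R 0 sG) (symmetric3E 2%:R 1 sG).
rewrite !relaxedE !EEE// !correctorE /=.
have h : la + mu != 0 by rewrite gt_eqF// ltr_wpDl.
by rewrite /young_modulus /poisson_ratio; field.
Qed.

Lemma elementary_EE (K : 'M[R]_3) (a : R) i j : skew3 K ->
  elementary (fun x => EE K a (x, 0) i j).
Proof.
move=> sK; under eq_fun do rewrite (EEE _ _ sK).
case: ((i == 0) && (j == 0)); first by repeat constructor.
case: ((i == 0) && (j == 1) || (i == 1) && (j == 0)); first by repeat constructor.
by case: ((i == 0) && (j == 2%:R) || (i == 2%:R) && (j == 0)); repeat constructor.
Qed.

Lemma relaxed_Hspace K a : skew3 K -> Hspace (relaxed K a).
Proof.
move=> sK; apply: HspaceD; last exact: corrector_Hspace.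
split; last by apply: aeW => z _; exact: symmetric3_sym.
move=> i j.
apply: (@continuous_SY_L2 _ (fun x => EE K a (x, 0) i j)).
exact/elementary_continuous/elementary_EE.
Qed.

Lemma Hrel_corrector nu k2 k3 a gamma :
  Hrel gamma (fun z : (R * R) * R => corrector nu k2 k3 a z.1).
Proof.
have := @HrelD_corrector R nu k2 k3 a gamma _ (Hrel_zero R gamma).
by under eq_fun do rewrite add0r.
Qed.

Lemma Hrel_Hspace gamma (chi : tfield R) : Hrel gamma chi -> Hspace chi.
Proof. by case: gamma => -[]. Qed.

Lemma Hrel_perp_Hspace gamma (V : tfield R) : Hrel_perp mu la gamma V -> Hspace V.
Proof. by move=> [[]]. Qed.

Lemma relaxed_perp gamma K a : skew3 K -> Hrel_perp mu la gamma (relaxed K a).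
Proof.
move=> sK; have HP := relaxed_Hspace a sK; split.
  split => //; exists K, a, (fun z => corrector poisson_ratio (K 0 1) (K 0 2%:R) a z.1).
  by split => //; [exact: Hrel_corrector|exact: aeW].
move=> chi Hchi; have [LC sC] := Hrel_Hspace Hchi; have [LP _] := HP.
have [v [N rel]] := Hrel_relaxation Hchi.
have ca : continuous (fun x => young_modulus * axial (K 0 1) (K 0 2%:R) a x).
  by apply: elementary_continuous; repeat constructor.
have := has_integralD measurable_SY (relaxation_axial rel ca)
  (has_integralZ measurable_SY (2 * mu * K 1 2%:R) (relaxation_torsion rel)).
rewrite mulr0 addr0 => H.
have IP := inner_has_integral LP LC.
apply: (has_integral_uniq IP); apply: (has_integral_ae measurable_SY _ _ H).
  exact: (has_integral_measurable IP).
by apply: filterS sC => z sC Sz; rewrite LL_relaxed//; exact: sC.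
Qed.

(* A field [V = relaxed K a + chi] orthogonal to [chi] satisfies
   [inner chi chi = 0]. *)
Lemma Hrel_perp_relaxed gamma V : Hrel_perp mu la gamma V ->
  exists K a, skew3 K /\ ae_eq_SY V (relaxed K a).
Proof.
move=> [[[LV _] [K [a [chi [sK Hchi VE]]]]] Vperp].
(* The corrector is linear in its data, so subtracting the one hidden in [relaxed K a] means adding
   the one with opposite data; [HrelD_corrector] then applies. *)
pose chi' z := chi z + corrector poisson_ratio (- K 0 1) (- K 0 2%:R) (- a) z.1.
have Hchi' : Hrel gamma chi' by exact: HrelD_corrector.
have [LC sC] := Hrel_Hspace Hchi'.
have [LP _] := relaxed_Hspace a sK.
have VE' : ae_eq_SY V (fun z => relaxed K a z + chi' z).
  apply: filterS VE => z h Sz; rewrite (h Sz) /relaxed /chi' -!addrA; congr (_ + _).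
  rewrite addrCA -[LHS]addr0; congr (_ + _).
  apply/matrixP => i j; rewrite [in RHS]mxE [LHS]mxE !correctorE /axial.
  by case: ifP => _; ring.
exists K, a; split => //.
have I1 := inner_has_integral LV LC; rewrite (Vperp _ Hchi') in I1.
have I2 := inner_has_integral LP LC.
rewrite ((relaxed_perp gamma a sK).2 _ Hchi') in I2.
have I3 := has_integralB measurable_SY I1 I2; rewrite subrr in I3.
have I4 := inner_has_integral LC LC.
have E4 : has_integral leb3 SY (fun z => LL mu la (chi' z) (chi' z)) 0.
  apply: (has_integral_ae measurable_SY _ _ I3).
    exact: (has_integral_measurable I4).
  by apply: filterS VE' => z h Sz; rewrite (h Sz) LLDl addrC addKr.
have := has_integral_ge0_eq0 measurable_SY (fun z _ => LL_ge0 (chi' z)) E4.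
move=> C0; apply: filterS3 VE' sC C0 => z h sC C0 Sz.
by rewrite (h Sz) (LL_eq0 (sC Sz) (C0 Sz)) addr0.
Qed.

(** The two fields differ by a corrector, which belongs to the relaxation space and is therefore
    orthogonal to every admissible [V]. *)
Lemma is_Prel_EE gamma K a : skew3 K ->
  is_Prel mu la gamma (EE K a) (relaxed K a).
Proof.
move=> sK; split; first exact: relaxed_perp.
move=> V [_ Vperp]; rewrite innerC.
rewrite (_ : (fun z => EE K a z - relaxed K a z) = (fun z =>
    corrector poisson_ratio (- K 0 1) (- K 0 2%:R) (- a) z.1)).
  exact: (Vperp _ (Hrel_corrector _ _ _ _ gamma)).
apply/funext => z; rewrite /relaxed opprD addNKr.
apply/matrixP => i j; rewrite mxE !correctorE /axial.
by case: ifP => _; ring.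
Qed.

(** * Projection of an isotropic prestrain *)

Section ScalarPrestrain.
Variable b : (R * R) * R -> R.
Hypothesis Lb : L2 leb3 SY b.

Lemma symE_scalar c i j : sym (c%:M : 'M[R]_3) i j = c *+ (i == j).
Proof.
rewrite symE !mxE (eq_sym j i).
by case: (i == j); rewrite ?mulr1n ?mulr0n; lra.
Qed.

Lemma L2mx_scalar : L2mx leb3 SY (fun z => sym (b z)%:M).
Proof.
move=> i j; under eq_fun do rewrite symE_scalar.
case: (i == j); first by under eq_fun do rewrite mulr1n.
under eq_fun do rewrite mulr0n.
by apply: (@continuous_SY_L2 _ (fun=> 0)) => x; exact: cvg_cst.
Qed.

(** By [Hrel_perp_relaxed] it suffices to test against relaxed fields. An isotropic prestrain has no
    shear, so a torsion-free candidate leaves a residual whose first row is (b - axial, 0, 0), and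
    the pairing is Young's modulus times a scalar integral. *)
Lemma is_Prel_scalar gamma K a : skew3 K -> K 1 2%:R = 0 ->
  (forall K' a', skew3 K' -> has_integral leb3 SY (fun z =>
    axial (K' 0 1) (K' 0 2%:R) a' z.1 *
    (b z - axial (K 0 1) (K 0 2%:R) a z.1)) 0) ->
  is_Prel mu la gamma (fun z => sym (b z)%:M) (relaxed K a).
Proof.
move=> sK K12 orth; split; first exact: relaxed_perp.
move=> V Vperp; have [K' [a' [sK' VE]]] := Hrel_perp_relaxed Vperp.
have [LV _] := Hrel_perp_Hspace Vperp.
have [LP _] := relaxed_Hspace a sK; have [LP' _] := relaxed_Hspace a' sK'.
have LF : L2mx leb3 SY (fun z => sym (b z)%:M - relaxed K a z).
  move=> i j; under eq_fun do rewrite mxE [X in _ + X]mxE.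
  exact: (L2B measurable_SY (L2mx_scalar i j) (LP i j)).
rewrite (inner_ae LF LV LP' VE) innerC.
have := has_integralZ measurable_SY young_modulus (orth _ a' sK').
rewrite mulr0; apply: has_integral_uniq.
apply: (eq_has_integral measurable_SY _ erefl) (inner_has_integral LP' LF).
move=> z _; rewrite LL_relaxed//; last first.
  rewrite /symmetric3 linearB /=; congr (_ - _); first exact: symmetric3_sym.
  by rewrite /relaxed linearD /=; congr (_ + _); exact: symmetric3_sym.
have D i j : (sym (b z)%:M - relaxed K a z) i j =
    b z *+ (i == j) - (EE K a z i j + corrector poisson_ratio (K 0 1) (K 0 2%:R) a z.1 i j).
  by rewrite [LHS]mxE symE_scalar [X in _ + X]mxE relaxedE.
by rewrite !D !EEE// !correctorE /= K12; ring.
Qed.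

(** The unknown representative [P] drops out on subtracting its two orthogonality relations, tested
    against [relaxed K' a']. As [K'] is torsion-free, the torsion of [K] does not enter the
    pairing. *)
Lemma is_Prel_scalar_orth gamma K a P : skew3 K ->
  is_Prel mu la gamma (EE K a) P ->
  is_Prel mu la gamma (fun z => sym (b z)%:M) P ->
  forall K' a', skew3 K' -> K' 1 2%:R = 0 -> has_integral leb3 SY (fun z =>
    axial (K' 0 1) (K' 0 2%:R) a' z.1 *
    (b z - axial (K 0 1) (K 0 2%:R) a z.1)) 0.
Proof.
move=> sK [Pperp HE] [_ HB] K' a' sK' K'12.
have [LP _] := Hrel_perp_Hspace Pperp.
have [LP' _] := relaxed_Hspace a' sK'.
have LE : L2mx leb3 SY (EE K a).
  move=> i j; apply: (@continuous_SY_L2 _ (fun x => EE K a (x, 0) i j)).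
  exact/elementary_continuous/elementary_EE.
have := HE _ (relaxed_perp gamma a' sK'); have := HB _ (relaxed_perp gamma a' sK').
rewrite (innerBl LE LP LP') (innerBl L2mx_scalar LP LP') => B0 E0.
have EB : inner mu la (relaxed K' a') (fun z => sym (b z)%:M) -
    inner mu la (relaxed K' a') (EE K a) = 0.
  rewrite innerC (innerC _ (EE K a)).
  move: B0 E0 => /eqP; rewrite subr_eq0 => /eqP-> /eqP; rewrite subr_eq0 => /eqP->.
  exact: subrr.
have := has_integralB measurable_SY (inner_has_integral LP' L2mx_scalar)
  (inner_has_integral LP' LE).
rewrite EB => /(has_integralZ measurable_SY young_modulus^-1).
rewrite mulr0; apply: (eq_has_integral measurable_SY _ erefl) => z _.
rewrite !LL_relaxed//; [|exact: symmetric3_sym|exact: symmetric3_sym].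
rewrite !symE_scalar !EEE//= K'12.
have E0' : young_modulus != 0 by rewrite gt_eqF// young_modulus_gt0.
by field.
Qed.

End ScalarPrestrain.

End Energy.

(** * Moments of the half disc *)

Section Preserving.
Context {R : realType}.
Local Notation mR := (measurableTypeR R).
Local Notation mRR := (mR * mR)%type.

(** A map preserving the measure of rectangles pushes the product measure to itself, by uniqueness
    of the product measure; the claim is then the change of variables for a pushforward. *)
Lemma disc_integral_preserving (phi : mRR -> mRR) (f : mRR -> R) c :
  measurable_fun setT phi ->
  (forall A B : set mR, measurable A -> measurable B ->
    (@leb2 R) (phi @^-1` (A `*` B)) = (leb1 A * leb1 B)%E) ->
  (forall x, Scell (phi x) = Scell x) ->
  measurable_fun setT f -> (forall x, Scell x -> `|f x| <= c) ->
  \int[leb2]_(x in Scell) f (phi x) = \int[leb2]_(x in Scell) f x.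
Proof.
move=> mphi rect Sphi mf fc.
pose phi' : {mfun mRR >-> mRR} := HB.pack phi (isMeasurableFun.Build _ _ _ _ phi mphi).
have pE (A : set mRR) : measurable A -> pushforward leb2 phi A = leb2 A.
  move=> mA; apply/esym.
  by apply: (@product_measure_unique _ _ mR mR R (@lebesgue_measure R) (@lebesgue_measure R)
    (pushforward leb2 phi')).
have Sp : phi @^-1` Scell = Scell by apply/seteqP; split => x; rewrite /= Sphi.
have fi : leb2.-integrable (phi @^-1` Scell) ((EFin \o f) \o phi).
  rewrite Sp; apply: (@integrable_bounded _ _ _ _ _ measurable_Scell leb2_Scell_fin (f \o phi) c).
    by apply: measurable_funTS; exact: measurableT_comp.
  by move=> x Sx; rewrite /= fc// Sphi.
have mEf : measurable_fun setT (EFin \o f) by exact/measurable_EFinP.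
have H := @integral_pushforward _ _ mRR mRR R phi mphi leb2 Scell _ mEf fi measurable_Scell.
have H1 := congr1 (fun D => integral leb2 D ((EFin \o f) \o phi)) Sp.
have H2 : (\int[pushforward leb2 phi']_(y in Scell) (EFin \o f) y =
           \int[leb2]_(y in Scell) (EFin \o f) y)%E.
  by apply: eq_measure_integral => A mA _; exact: pE.
exact: (congr1 fine (etrans (esym H1) (etrans (esym H) H2))).
Qed.

Lemma measurable_opp_preimage (A : set mR) : measurable A ->
  measurable (-%R @^-1` A : set mR).
Proof. by move=> mA; rewrite -[X in measurable X]setTI; exact: oppr_measurable. Qed.

Lemma leb1N (A : set mR) : measurable A -> (@leb1 R) (-%R @^-1` A) = leb1 A.
Proof. exact: lebesgue_measureN. Qed.

Lemma disc_integral_opp (f : mRR -> R) c : measurable_fun setT f ->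
  (forall x, Scell x -> `|f x| <= c) ->
  \int[leb2]_(x in Scell) f (- x.1, - x.2) = \int[leb2]_(x in Scell) f x.
Proof.
move=> mf fc; apply: (disc_integral_preserving (phi := fun x => (- x.1, - x.2))) mf fc.
- apply: measurable_fun_pair; apply: measurableT_comp => //.
- move=> A B mA mB.
  rewrite (_ : _ @^-1` _ = (-%R @^-1` A) `*` (-%R @^-1` B))//.
  rewrite -[in RHS]leb1N// -[in X in (_ * X)%E]leb1N//; apply: product_measure1E.
    exact: measurable_opp_preimage.
  exact: measurable_opp_preimage.
- by move=> x; rewrite /Scell/= !sqrrN.
Qed.

Lemma disc_integral_opp1 (f : mRR -> R) c : measurable_fun setT f ->
  (forall x, Scell x -> `|f x| <= c) ->
  \int[leb2]_(x in Scell) f (- x.1, x.2) = \int[leb2]_(x in Scell) f x.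
Proof.
move=> mf fc; apply: (disc_integral_preserving (phi := fun x => (- x.1, x.2))) mf fc.
- apply: measurable_fun_pair => //; apply: measurableT_comp => //.
- move=> A B mA mB.
  rewrite (_ : _ @^-1` _ = (-%R @^-1` A) `*` B)//.
  rewrite -[in RHS]leb1N//; apply: product_measure1E => //.
  exact: measurable_opp_preimage.
- by move=> x; rewrite /Scell/= !sqrrN.
Qed.

Lemma disc_integral_swap (f : mRR -> R) c : measurable_fun setT f ->
  (forall x, Scell x -> `|f x| <= c) ->
  \int[leb2]_(x in Scell) f (x.2, x.1) = \int[leb2]_(x in Scell) f x.
Proof.
move=> mf fc; apply: (disc_integral_preserving (phi := fun x => (x.2, x.1))) mf fc.
- by apply: measurable_fun_pair.
- move=> A B mA mB.
  rewrite (_ : _ @^-1` _ = B `*` A); last by apply/seteqP; split => x [].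
  by rewrite muleC; exact: product_measure1E.
- by move=> x; rewrite /Scell/= addrC.
Qed.

End Preserving.

(** * Integration along the chords of the disc *)

Section Slices.
Context {R : realType}.
Local Notation mR := (measurableTypeR R).
Local Notation mRR := (mR * mR)%type.

Definition half_chord (y : R) : R := Num.sqrt (1 - y ^+ 2).

Lemma half_chord_sqr (y : R) : y \in `]-1, 1[ -> half_chord y ^+ 2 = 1 - y ^+ 2.
Proof. by rewrite in_itv/= => /andP[y1 y2]; rewrite sqr_sqrtr//; nra. Qed.

Lemma half_chord_gt0 (y : R) : y \in `]-1, 1[ -> 0 < half_chord y.
Proof. by rewrite in_itv/= => /andP[y1 y2]; rewrite sqrtr_gt0; nra. Qed.

Lemma chord_Scell (x y : R) : y \in `]-1, 1[ ->
  (x ^+ 2 + y ^+ 2 < 1) = (- half_chord y < x < half_chord y).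
Proof.
move=> y1; rewrite -ltr_norml -ltrBrDr -half_chord_sqr//.
by rewrite -real_normK ?num_real// ltr_pXn2r// nnegrE// ltW// half_chord_gt0.
Qed.

Lemma ysection_Scell (y : R) : y \in `]-1, 1[ ->
  ysection Scell y = `]- half_chord y, half_chord y[%classic.
Proof.
move=> y1; rewrite ysectionE; apply/seteqP.
by split => x; rewrite /Scell/= in_itv/= chord_Scell.
Qed.

Lemma xsection_Scell (x : R) : x \in `]-1, 1[ ->
  xsection Scell x = `]- half_chord x, half_chord x[%classic.
Proof.
move=> x1; rewrite xsectionE; apply/seteqP.
by split => y; rewrite /Scell/= in_itv/= addrC chord_Scell.
Qed.

Lemma ysection_Scell0 (y : R) : y \notin `]-1, 1[ -> ysection Scell y = set0.
Proof.
move=> y1; rewrite ysectionE; apply/seteqP; split => // x.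
rewrite /Scell/= => h; case/negP: y1; rewrite in_itv/=; have := sqr_ge0 x => ?.
by apply/andP; split; nra.
Qed.

Lemma xsection_Scell0 (x : R) : x \notin `]-1, 1[ -> xsection Scell x = set0.
Proof.
move=> y1; rewrite xsectionE; apply/seteqP; split => // y.
rewrite /Scell/= => h; case/negP: y1; rewrite in_itv/=; have := sqr_ge0 y => ?.
by apply/andP; split; nra.
Qed.

Lemma Scell_fubini2 (f : mRR -> R) (g : R -> R) :
  leb2.-integrable Scell (EFin \o f) -> measurable_fun (`]-1, 1[%classic : set mR) g ->
  {ae leb1, forall y, `]-1, 1[%classic y ->
     \int[leb1]_(x in `]- half_chord y, half_chord y[) f (x, y) = g y} ->
  has_integral leb1 (`]-1, 1[%classic : set mR) g (\int[leb2]_(x in Scell) f x).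
Proof.
move=> fi mg fg.
apply: (@Rfubini2 _ _ mR mR R (@lebesgue_measure R) (@lebesgue_measure R) _
  measurable_Scell _ fi) => //.
- by apply: aeW => y /negP; exact: ysection_Scell0.
- by apply: filterS fg => y h y1; rewrite ysection_Scell//; exact: h.
Qed.

Lemma Scell_fubini1 (f : mRR -> R) (g : R -> R) :
  leb2.-integrable Scell (EFin \o f) -> measurable_fun (`]-1, 1[%classic : set mR) g ->
  {ae leb1, forall x, `]-1, 1[%classic x ->
     \int[leb1]_(y in `]- half_chord x, half_chord x[) f (x, y) = g x} ->
  has_integral leb1 (`]-1, 1[%classic : set mR) g (\int[leb2]_(x in Scell) f x).
Proof.
move=> fi mg fg.
apply: (@Rfubini1 _ _ mR mR R (@lebesgue_measure R) (@lebesgue_measure R) _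
  measurable_Scell _ fi) => //.
- by apply: aeW => y /negP; exact: xsection_Scell0.
- by apply: filterS fg => y h y1; rewrite xsection_Scell//; exact: h.
Qed.

Lemma integral_deriv_poly (p : {poly R}) (a b : R) : a <= b ->
  \int[leb1]_(x in `]a, b[) (p^`()).[x] = p.[b] - p.[a].
Proof.
rewrite le_eqVlt => /predU1P[<-|ab].
  by rewrite set_itvoo0 Rintegral_set0 subrr.
have cf : continuous (horner p^`()) by exact: continuous_horner.
have cF : continuous (horner p) by exact: continuous_horner.
have fi : leb1.-integrable `[a, b] (EFin \o horner p^`()).
  apply: continuous_compact_integrable; first exact: segment_compact.
  exact: continuous_subspaceT.
rewrite Rintegral_itv_obnd_cbnd; last first.
  by apply: integrableS fi => //; exact: subset_itv_oo_cc.
rewrite Rintegral_itv_bndo_bndc; last first.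
  by apply: integrableS fi => //; exact: subset_itv_co_cc.
rewrite /Rintegral (@continuous_FTC2 _ (horner p^`()) (horner p) a b)//.
- exact: continuous_subspaceT.
- split; first by move=> x _; exact: derivable_horner.
    exact/cvg_at_right_filter/cF.
  exact/cvg_at_left_filter/cF.
- by move=> x _; rewrite -derivE.
Qed.

Lemma integral_id (a b : R) : a <= b ->
  \int[leb1]_(x in `]a, b[) x = (b ^+ 2 - a ^+ 2) / 2.
Proof.
move=> ab; have := integral_deriv_poly (2^-1 *: 'X^2) ab.
rewrite derivZ derivXn !(hornerZ, hornerXn) => H.
transitivity (2^-1 * b ^+ 2 - 2^-1 * a ^+ 2); last by field.
rewrite -H; apply: eq_Rintegral => x _.
by rewrite hornerZ hornerMn hornerXn; field.
Qed.

(** The positive part covers the three positions of the threshold [d]: left of the interval, where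
    the integral of x over a symmetric interval is 0; right of it, where nothing is left; inside,
    where the integral runs from d to s. *)
Lemma integral_moving_half (s d : R) : 0 < s ->
  \int[leb1]_(x in `]- s, s[) ((d < x)%R%:R * x) = Num.max 0 ((s ^+ 2 - d ^+ 2) / 2).
Proof.
move=> s0.
have [ds|ds] := leP d (- s).
  rewrite max_l; last by nra.
  transitivity (\int[leb1]_(x in `]- s, s[) x).
    apply: eq_Rintegral => x; rewrite inE/= in_itv/= => /andP[sx _].
    by rewrite (le_lt_trans ds sx) mul1r.
  rewrite integral_id//; first by field.
  lra.
have [sd|sd] := leP s d.
  rewrite max_l; last by nra.
  rewrite -[RHS](@has_integral0 _ mR R leb1 `]- s, s[%classic).2.
  apply: eq_Rintegral => x; rewrite inE/= in_itv/= => /andP[_ xs].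
  by rewrite ltNge (le_trans (ltW xs) sd) mul0r.
rewrite max_r; last by nra.
rewrite -integral_id ?ltW//.
have -> : `]d, s[%classic = `]- s, s[%classic `&` `]d, +oo[%classic :> set R.
  apply/seteqP; split => x /=; rewrite !in_itv/= ?andbT.
    by move=> /andP[dx xs]; split => //; rewrite xs (lt_trans ds dx).
  by move=> [/andP[_ ->] ->].
rewrite Rintegral_mkcondr; apply: eq_Rintegral => x _.
rewrite patchE; have [dx|dx] := boolP (d < x).
  by rewrite mul1r ifT// inE/= in_itv/= dx.
by rewrite mul0r ifF//; apply/negbTE; apply: contra dx; rewrite inE/= in_itv/= andbT.
Qed.

(** The integrand is what [integral_moving_half] gives on the chord at height y for a half plane
    whose normal has first component [n]. The positive part restricts to |y| < n, leaving the
    integral of a parabola. *)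
Lemma integral_moving_outer (n : R) : 0 < n <= 1 ->
  \int[leb1]_(y in `](-1), 1[) (Num.max 0 ((1 - y ^+ 2 / n ^+ 2) / 2)) = 2 / 3 * n.
Proof.
move=> /andP[n0 n1]; have n_neq0 : n != 0 by rewrite gt_eqF.
transitivity (\int[leb1]_(y in `]- n, n[) ((1 - y ^+ 2 / n ^+ 2) / 2)).
  have -> : `]- n, n[%classic = `]-1, 1[%classic `&` `]- n, n[%classic :> set R.
    apply/seteqP; split => x /=; last by case.
    by rewrite !in_itv/= => /andP[a b]; rewrite a b; split => //; apply/andP; lra.
  rewrite Rintegral_mkcondr; apply: eq_Rintegral => x _.
  have E : (1 - x ^+ 2 / n ^+ 2) / 2 = (n ^+ 2 - x ^+ 2) / (2 * n ^+ 2) by field.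
  have n2 : 0 < 2 * n ^+ 2 by rewrite mulr_gt0// exprn_gt0.
  rewrite patchE; case: ifPn => [|/negP]; rewrite inE/= in_itv/=.
    move=> /andP[a b]; rewrite max_r// E divr_ge0 ?(ltW n2)//; nra.
  move=> h; rewrite max_l// E; rewrite ler_pdivrMr// mul0r subr_le0.
  by rewrite leNgt; apply/negP => hx; apply: h; apply/andP; split; nra.
have nn : - n <= n by lra.
have := integral_deriv_poly (2^-1 *: 'X - (6 * n ^+ 2)^-1 *: 'X^3) nn.
rewrite derivB !derivZ derivX derivXn !(hornerD, hornerN, hornerZ, hornerX, hornerXn) => H.
transitivity (2^-1 * n - (6 * n ^+ 2)^-1 * n ^+ 3 -
   (2^-1 * - n - (6 * n ^+ 2)^-1 * (- n) ^+ 3)); last by field.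
rewrite -H; apply: eq_Rintegral => x _.
by rewrite !(hornerD, hornerN, hornerZ, hornerMn, hornerXn, hornerC); field.
Qed.

Lemma continuous_half_chord : continuous half_chord.
Proof.
move=> x; apply: (@continuous_comp _ _ _ (fun y : R => 1 - y ^+ 2) Num.sqrt).
  by apply: continuousB; [exact: cvg_cst|exact: exprn_continuous].
exact: sqrt_continuous.
Qed.

Lemma continuous_sqr_half_chord :
  continuous (fun x : R => x ^+ 2 * (2 * half_chord x)).
Proof.
move=> x; apply: (@continuousM _ _ (fun x : R => x ^+ 2) (fun x => 2 * half_chord x)).
  exact: exprn_continuous.
apply: (@continuousM _ _ (fun=> 2) half_chord); first exact: cvg_cst.
exact: continuous_half_chord.
Qed.

(** The substitution x = sin t turns the chord length into 2 cos t and the integrand into 2 sin^2 t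
    cos^2 t on [-pi/2, pi/2]. *)
Lemma integral_sqr_half_chord :
  \int[leb1]_(x in `]-1, 1[) (x ^+ 2 * (2 * half_chord x)) = pi / 4.
Proof.
pose g (x : R) := x ^+ 2 * (2 * half_chord x).
have cg : continuous g by exact: continuous_sqr_half_chord.
have gi : leb1.-integrable `[-1, 1] (EFin \o g).
  apply: continuous_compact_integrable; first exact: segment_compact.
  exact: continuous_subspaceT.
rewrite -/g Rintegral_itv_obnd_cbnd; last first.
  by apply: integrableS gi => //; exact: subset_itv_oo_cc.
rewrite Rintegral_itv_bndo_bndc; last first.
  by apply: integrableS gi => //; exact: subset_itv_co_cc.
have pi2 : - (pi / 2) < pi / 2 :> R by have := pi_gt0 R; lra.
have dsin : (@sin R)^`()%classic = cos.
  by apply/funext => x; rewrite derive1E derive_val.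
have := @integration_by_substitution_increasing R sin g (- (pi / 2)) (pi / 2) (ltW pi2).
rewrite sinN sin_pihalf dsin /Rintegral => -> //; last 6 first.
- move=> x y xI yI; rewrite ltr_sin//.
- by move=> x _; exact: continuous_cos.
- by apply/cvg_ex; exists (cos (- (pi / 2))); exact/cvg_at_right_filter/continuous_cos.
- by apply/cvg_ex; exists (cos (pi / 2)); exact/cvg_at_left_filter/continuous_cos.
- split; first by move=> x _; exact: ex_derive.
    exact/cvg_at_right_filter/continuous_sin.
  exact/cvg_at_left_filter/continuous_sin.
- exact: continuous_subspaceT.
(* This is t/4 - sin(4t)/16, an antiderivative of sin^2(2t)/2, which equals [f]. *)
pose F (t : R) := t / 4 - sin t * cos t * (cos t * cos t - sin t * sin t) / 4.
pose f (t : R) := 2 * (sin t ^+ 2 * cos t ^+ 2).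
transitivity (fine (\int[lebesgue_measure]_(x in `[(- (pi / 2))%R, (pi / 2)%R]) (f x)%:E)%E).
  congr fine; apply: eq_integral => x; rewrite inE/= in_itv/= => xI; congr EFin.
  rewrite (_ : ((g \o sin) * cos) x = g (sin x) * cos x)// /g /f /half_chord.
  by rewrite -cos2sin2 sqrtr_sqr ger0_norm ?cos_ge0_pihalf//; ring.
have dF (t : R) : is_derive t 1 F (f t).
  have ds := is_derive_sin t; have dc := is_derive_cos t.
  have := is_deriveB (is_deriveM (is_derive_id t (1 : R)) (is_derive_cst (4^-1 : R) t (1 : R)))
    (is_deriveM (is_deriveM (is_deriveM ds dc)
       (is_deriveB (is_deriveM dc dc) (is_deriveM ds ds)))
     (is_derive_cst (4^-1 : R) t (1 : R))).
  set D := (X in is_derive _ _ _ X -> _).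
  have -> : D = f t.
    rewrite /D /f /GRing.scale /= /cst.
    have -> : (sin * cos * (cos * cos - sin * sin)) t =
      sin t * cos t * (cos t * cos t - sin t * sin t) by [].
    have -> : (sin * cos) t = sin t * cos t by [].
    have -> : (cos * cos - sin * sin) t = cos t * cos t - sin t * sin t by [].
    (* Writing 1 as a power of cos^2 + sin^2 makes the identity homogeneous of degree 4 in cos t and
       sin t, hence purely algebraic. *)
    have -> : 4^-1 * 1 = 4^-1 * (cos t ^+ 2 + sin t ^+ 2) ^+ 2 :> R.
      by rewrite cos2Dsin2 expr1n.
    by field.
  by [].
have cF : continuous F.
  by move=> s; apply/differentiable_continuous/derivable1_diffP; have [] := dF s.
rewrite (@continuous_FTC2 _ f F)//.
- by rewrite -EFinB /= /F cosN sinN cos_pihalf sin_pihalf; field.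
- apply: continuous_subspaceT => t.
  apply: (@continuousM _ _ (fun=> 2) (fun t => sin t ^+ 2 * cos t ^+ 2)).
    exact: cvg_cst.
  apply: (@continuousM _ _ (fun t => sin t ^+ 2) (fun t => cos t ^+ 2)).
    exact: (continuous_comp (@continuous_sin R t) (@exprn_continuous R 2 _)).
  exact: (continuous_comp (@continuous_cos R t) (@exprn_continuous R 2 _)).
- split; first by move=> t _; have [] := dF t.
    exact/cvg_at_right_filter/cF.
  exact/cvg_at_left_filter/cF.
- by move=> t _; rewrite derive1E; have [] := dF t.
Qed.

Lemma disc_integral_sqr1 : has_integral leb2 (@Scell R) (fun x => x.1 ^+ 2) (pi / 4).
Proof.
have cf : continuous (fun x : R * R => x.1 ^+ 2).
  have := @elementary_continuous R (fun x => x.1 * x.1).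
  by apply; repeat constructor.
have fi := L2_integrable measurable_Scell leb2_Scell_fin (continuous_L2_Scell cf).
split => //; rewrite -integral_sqr_half_chord.
have mg : measurable_fun (`]-1, 1[%classic : set mR)
    (fun x : R => x ^+ 2 * (2 * half_chord x)).
  apply: measurable_funTS; apply: continuous_measurable_fun.
  exact: continuous_sqr_half_chord.
have [|_ <-//] := Scell_fubini1 fi mg.
apply: aeW => x x1 /=.
rewrite Rintegral_cst//; congr (_ * _).
transitivity (fine (@lebesgue_measure R `]- half_chord x, half_chord x[%classic)).
  by [].
rewrite lebesgue_measure_itv/= lte_fin ifT/=; first by ring.
by have := half_chord_gt0 x1; lra.
Qed.

Definition half_plane (n1 n2 : R) : set mRR := [set x | 0 < n1 * x.1 + n2 * x.2].

Lemma measurable_half_plane n1 n2 : measurable (half_plane n1 n2).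
Proof.
apply: measurable_open_prod.
apply: (@open_comp _ _ (fun x : R * R => n1 * x.1 + n2 * x.2) [set t : R | 0 < t]).
  by move=> x _; apply: elementary_continuous; repeat constructor.
exact: open_gt.
Qed.

Lemma half_planeE n1 n2 x :
  \1_(half_plane n1 n2) x = (0 < n1 * x.1 + n2 * x.2)%R%:R :> R.
Proof. by rewrite indicE; congr (_%:R); congr nat_of_bool; apply/idP/idP; rewrite inE. Qed.

End Slices.

(** * Area and first moments of a half disc *)

Section HalfDisc.
Context {R : realType}.
Local Notation mR := (measurableTypeR R).
Local Notation mRR := (mR * mR)%type.

Lemma measurable_half_plane_mul n1 n2 (q : R * R -> R) : continuous q ->
  measurable_fun (setT : set mRR) (fun x => \1_(half_plane n1 n2) x * q x).
Proof.
move=> cq; apply: measurable_funM; last exact: measurable_continuous_prod.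
by apply: measurable_indic; exact: measurable_half_plane.
Qed.

Lemma half_plane_mul_bounded n1 n2 (q : R * R -> R) c x : `|q x| <= c ->
  `|\1_(half_plane n1 n2) x * q x| <= c.
Proof.
by rewrite half_planeE => qc; case: (_ < _); rewrite ?mul1r ?mul0r ?normr0//
  (le_trans _ qc).
Qed.

Lemma half_plane_mul_integrable n1 n2 (q : R * R -> R) : continuous q ->
  leb2.-integrable Scell (EFin \o (fun x => \1_(half_plane n1 n2) x * q x)).
Proof.
move=> cq; have [c qc] := continuous_bounded_Scell cq.
apply: (@integrable_bounded _ _ _ _ _ measurable_Scell leb2_Scell_fin _ c).
  by apply: measurable_funTS; exact: measurable_half_plane_mul.
by move=> x Sx; apply: half_plane_mul_bounded; exact: qc.
Qed.

Let c1 : continuous (fun x : R * R => x.1).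
Proof. exact/elementary_continuous/elementary_fst. Qed.
Let c2 : continuous (fun x : R * R => x.2).
Proof. exact/elementary_continuous/elementary_snd. Qed.

(** At height y the half plane is x > d with d = - n2 y / n1. Since the normal is a unit vector, (1
    - y^2) - d^2 = 1 - y^2 / n1^2. *)
Lemma half_disc_moment1_gt0 (n1 n2 : R) : 0 < n1 -> n1 ^+ 2 + n2 ^+ 2 = 1 ->
  \int[leb2]_(x in Scell) (\1_(half_plane n1 n2) x * x.1) = 2 / 3 * n1.
Proof.
move=> n1_gt0 n12; have n1_neq0 : n1 != 0 by rewrite gt_eqF.
have n1_le1 : n1 <= 1 by have := sqr_ge0 n2; nra.
rewrite -(@integral_moving_outer _ n1) ?n1_gt0//.
have mg : measurable_fun (`]-1, 1[%classic : set mR)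
    (fun y : R => Num.max 0 ((1 - y ^+ 2 / n1 ^+ 2) / 2)).
  apply: measurable_maxr => //; apply: measurable_funM => //.
  apply: measurable_funB => //; apply: measurable_funM => //.
have [|_ <-//] := Scell_fubini2 (half_plane_mul_integrable n1 n2 c1) mg.
apply: aeW => y y1.
have E : (1 - y ^+ 2 / n1 ^+ 2) / 2 =
   (half_chord y ^+ 2 - (- (n2 * y) / n1) ^+ 2) / 2.
  rewrite half_chord_sqr//.
  have -> : (- (n2 * y) / n1) ^+ 2 = (1 - n1 ^+ 2) * y ^+ 2 / n1 ^+ 2.
    by rewrite -n12; field.
  by field.
rewrite E -integral_moving_half; last exact: half_chord_gt0.
apply: eq_Rintegral => x _; rewrite half_planeE/=; congr (_%:R * _); congr nat_of_bool.
rewrite ltr_pdivrMr//; apply/idP/idP; lra.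
Qed.

Lemma half_planeN n1 n2 (x : R * R) :
  \1_(half_plane n1 n2) (- x.1, - x.2) = \1_(half_plane (- n1) (- n2)) x :> R.
Proof. by rewrite !half_planeE /=; congr (_%:R); congr nat_of_bool; congr (_ < _); ring. Qed.

(** The slicing argument requires [n1 > 0]. Negative [n1] is reached by the central symmetry; for
    [n1 = 0] the reflection of the first coordinate preserves the half plane and makes the moment
    its own opposite. *)
Lemma half_disc_moment1 (n1 n2 : R) : n1 ^+ 2 + n2 ^+ 2 = 1 ->
  \int[leb2]_(x in Scell) (\1_(half_plane n1 n2) x * x.1) = 2 / 3 * n1.
Proof.
move=> n12; have [n10|n10|n10] := ltgtP n1 0; last 2 first.
- exact: half_disc_moment1_gt0.
- have := @disc_integral_opp1 _ _ 1 (measurable_half_plane_mul n1 n2 c1) (fun x Sx =>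
     half_plane_mul_bounded n1 n2 (Scell_le1 Sx).1).
  set I := (X in _ = X -> _).
  have -> : \int[leb2]_(x in Scell)
      (\1_(half_plane n1 n2) (- x.1, x.2) * (- x.1, x.2).1) = - I.
    rewrite -mulN1r -RintegralZl; [|exact: measurable_Scell|exact: half_plane_mul_integrable].
    by apply: eq_Rintegral => x _; rewrite !half_planeE n10 /= !mul0r; ring.
  by rewrite -/I n10 mulr0 => h; lra.
- have := @disc_integral_opp _ _ 1 (measurable_half_plane_mul n1 n2 c1) (fun x Sx =>
     half_plane_mul_bounded n1 n2 (Scell_le1 Sx).1).
  move=> <-; have N : 0 < - n1 by rewrite oppr_gt0.
  have := @half_disc_moment1_gt0 (- n1) (- n2) N; rewrite !sqrrN => /(_ n12) H.
  transitivity (- (\int[leb2]_(x in Scell) (\1_(half_plane (- n1) (- n2)) x * x.1))).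
    rewrite -mulN1r -RintegralZl; [|exact: measurable_Scell|exact: half_plane_mul_integrable].
    by apply: eq_Rintegral => x _; rewrite half_planeN/=; ring.
  by rewrite H; ring.
Qed.

Lemma half_disc_moment2 (n1 n2 : R) : n1 ^+ 2 + n2 ^+ 2 = 1 ->
  \int[leb2]_(x in Scell) (\1_(half_plane n1 n2) x * x.2) = 2 / 3 * n2.
Proof.
move=> n12; have n21 : n2 ^+ 2 + n1 ^+ 2 = 1 by rewrite addrC.
rewrite -(half_disc_moment1 n21).
rewrite -(@disc_integral_swap _ _ 1 (measurable_half_plane_mul n1 n2 c2) (fun x Sx =>
     half_plane_mul_bounded n1 n2 (Scell_le1 Sx).2)).
apply: eq_Rintegral => x _; rewrite !half_planeE/=.
by rewrite addrC.
Qed.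

Definition line (n1 n2 : R) : set mRR := [set x | n1 * x.1 + n2 * x.2 = 0].

Lemma measurable_line n1 n2 : measurable (line n1 n2).
Proof.
rewrite -[line _ _]setTI.
have := @measurable_continuous_prod _ (fun x => n1 * x.1 + n2 * x.2) setT.
move=> /(_ _ measurableT [set 0] (measurable_set1 0)); apply.
by apply: elementary_continuous; repeat constructor.
Qed.

Lemma line_integrable n1 n2 : leb2.-integrable Scell (EFin \o \1_(line n1 n2) : mRR -> \bar R).
Proof.
apply: (@integrable_bounded _ _ _ _ _ measurable_Scell leb2_Scell_fin _ 1).
  by apply: measurable_indic; exact: measurable_line.
by move=> x Sx; rewrite indicE; case: (_ \in _); rewrite ?normr1 ?normr0.
Qed.

Lemma line_integral_neq0 n1 n2 : n1 != 0 ->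
  \int[leb2]_(x in Scell) \1_(line n1 n2) x = 0 :> R.
Proof.
move=> n1_neq0.
have [||_ <-//] := @Scell_fubini2 _ _ (fun=> 0) (line_integrable n1 n2); first by [].
  apply: aeW => y _.
  have L x : \1_(line n1 n2) (x, y) = \1_([set - (n2 * y) / n1] : set mR) x :> R.
    rewrite !indicE; congr (_%:R); congr nat_of_bool.
    apply/idP/idP; rewrite !inE /line/= => h; last by rewrite h; field.
    by apply: (mulfI n1_neq0); rewrite mulrC mulrCA mulfV// mulr1; lra.
  under eq_Rintegral do rewrite L.
  set d := - (n2 * y) / n1.
  have := @has_integral_ae _ mR R leb1 `]- half_chord y, half_chord y[%classic _
    (fun=> 0) \1_([set d] : set mR) 0.
  move=> /(_ (measurable_itv _) (measurable_indic (measurable_set1 d)) _ (has_integral0 _ _)).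
  case=> //; exists [set d]; split; [exact: measurable_set1|exact: lebesgue_measure_set1|].
  move=> x /= h; apply: contrapT => xd; apply: h => _.
  by rewrite indicE memNset.
by rewrite (@has_integral0 _ mR R leb1 `]-1, 1[%classic).2.
Qed.

Lemma line_integral n1 n2 : n1 ^+ 2 + n2 ^+ 2 = 1 ->
  \int[leb2]_(x in Scell) \1_(line n1 n2) x = 0 :> R.
Proof.
move=> n12; have [n10|n10] := eqVneq n1 0; last exact: line_integral_neq0.
have n20 : n2 != 0.
  by apply: contra_eq_neq n12 => ->; rewrite n10 expr0n addr0 eq_sym oner_neq0.
rewrite -(line_integral_neq0 n1 n20).
rewrite -(@disc_integral_swap _ _ 1 (measurable_indic (measurable_line n2 n1))).
  apply: eq_Rintegral => x _; rewrite !indicE; congr (_%:R); congr nat_of_bool.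
  by apply/idP/idP; rewrite !inE /line/= addrC.
by move=> x Sx; rewrite indicE; case: (_ \in _); rewrite ?normr1 ?normr0.
Qed.

(** Kept symbolic: the area is a common factor of the stretching terms. *)
Definition disc_area : R := \int[leb2]_(x in @Scell R) 1.

(** The half plane and its opposite cover the disc up to a null line, and the central symmetry
    exchanges them. *)
Lemma half_disc_area n1 n2 : n1 ^+ 2 + n2 ^+ 2 = 1 ->
  \int[leb2]_(x in Scell) \1_(half_plane n1 n2) x = disc_area / 2.
Proof.
move=> n12.
have cst1 : continuous (fun _ : R * R => 1 : R) by move=> x; exact: cvg_cst.
have i n m := has_integral_integral (half_plane_mul_integrable n m cst1).
have L0 : {ae leb2, forall x, Scell x -> \1_(line n1 n2) x = 0 :> R}.
  apply: (has_integral_ge0_eq0 measurable_Scell).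
    by move=> x _; rewrite indicE ler0n.
  by split; [exact: line_integrable|exact: line_integral].
have A1 : has_integral leb2 (@Scell R) (fun=> 1) disc_area.
  apply: has_integral_integral.
  exact: (L2_integrable measurable_Scell leb2_Scell_fin (continuous_L2_Scell cst1)).
have S := has_integralD measurable_Scell (i n1 n2) (i (- n1) (- n2)).
have A2 : has_integral leb2 (@Scell R) (fun=> 1) (\int[leb2]_(x in Scell) (\1_(half_plane n1 n2) x * 1)
  + \int[leb2]_(x in Scell) (\1_(half_plane (- n1) (- n2)) x * 1)).
  apply: (has_integral_ae measurable_Scell _ _ S); first exact: measurable_cst.
  apply: filterS L0 => x h Sx; rewrite !half_planeE.
  have {}h : n1 * x.1 + n2 * x.2 != 0.
    apply/eqP => e; have := h Sx; rewrite indicE mem_set// => /eqP.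
    by rewrite oner_eq0.
  rewrite !mulr1 (_ : - n1 * x.1 + - n2 * x.2 = - (n1 * x.1 + n2 * x.2)); last by ring.
  by rewrite oppr_gt0; case: ltgtP h => // _ _; rewrite ?addr0 ?add0r.
have := has_integral_uniq A1 A2.
have := @disc_integral_opp _ _ 1 (measurable_half_plane_mul n1 n2 cst1) (fun x Sx =>
     half_plane_mul_bounded n1 n2 _).
under [X in (_ -> X = _) -> _]eq_Rintegral do rewrite half_planeN.
move=> -> => [->|_]; last by rewrite normr1.
have -> : \int[leb2]_(x in Scell) \1_(half_plane n1 n2) x =
    \int[leb2]_(x in Scell) (\1_(half_plane n1 n2) x * 1) :> R.
  by apply: eq_Rintegral => x _; rewrite mulr1.
by field.
Qed.

End HalfDisc.

Section Moments.
Context {R : realType}.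
Local Notation mR := (measurableTypeR R).
Local Notation mRR := (mR * mR)%type.
Local Notation A := (@disc_area R).

Let cont (q : R * R -> R) : elementary q -> continuous q.
Proof. exact: elementary_continuous. Qed.

Let odd_integral (q : R * R -> R) : continuous q ->
  (forall x, q (- x.1, - x.2) = - q x) \/ (forall x, q (- x.1, x.2) = - q x) ->
  has_integral leb2 Scell q 0.
Proof.
move=> cq oq; have [c qc] := continuous_bounded_Scell cq.
have qi := L2_integrable measurable_Scell leb2_Scell_fin (continuous_L2_Scell cq).
split => //; set I := (X in X = _).
have mq : measurable_fun (setT : set mRR) (q : mRR -> R) by exact: measurable_continuous_prod.
suff : - I = I by move=> ?; lra.
case: oq => oq; [rewrite -[RHS](disc_integral_opp mq qc)|rewrite -[RHS](disc_integral_opp1 mq qc)];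
  rewrite -mulN1r -RintegralZl//; try exact: measurable_Scell;
  by apply: eq_Rintegral => x _; rewrite oq mulN1r.
Qed.

Lemma disc_integral_sqr2 : has_integral leb2 (@Scell R) (fun x => x.2 ^+ 2) (pi / 4).
Proof.
have c2 : continuous (fun x : R * R => x.2 ^+ 2).
  have -> : (fun x : R * R => x.2 ^+ 2) = (fun x => x.2 * x.2) by [].
  by apply: cont; repeat constructor.
split; first exact: (L2_integrable measurable_Scell leb2_Scell_fin (continuous_L2_Scell c2)).
have [_ <-] := @disc_integral_sqr1 R.
have [c qc] := continuous_bounded_Scell c2.
by rewrite -(disc_integral_swap (measurable_continuous_prod c2) qc).
Qed.

(** By the symmetries of the disc the functions 1, x.1 and x.2 are pairwise orthogonal, so only the
    products of like terms survive. *)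
Lemma disc_axial_integral k2 k3 a l2 l3 b :
  has_integral leb2 Scell (fun x => axial l2 l3 b x * axial k2 k3 a x)
   (pi / 4 * (k2 * l2 + k3 * l3) + a * b * A).
Proof.
have i11 := @disc_integral_sqr1 R; have i22 := disc_integral_sqr2.
have i1 : has_integral leb2 (@Scell R) (fun x => x.1) 0.
  by apply: odd_integral; [apply: cont; constructor|left].
have i2 : has_integral leb2 (@Scell R) (fun x => x.2) 0.
  by apply: odd_integral; [apply: cont; constructor|left].
have i12 : has_integral leb2 (@Scell R) (fun x => x.1 * x.2) 0.
  by apply: odd_integral; [apply: cont; repeat constructor|right => x; rewrite mulNr].
have c1 : continuous (fun _ : R * R => 1 : R) by apply: cont; constructor.
have i0 : has_integral leb2 (@Scell R) (fun=> 1) A.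
  exact: has_integral_integral (L2_integrable measurable_Scell leb2_Scell_fin (continuous_L2_Scell c1)).
have Z k f c := @has_integralZ _ _ R leb2 Scell measurable_Scell k f c.
have D f g c c' := @has_integralD _ _ R leb2 Scell measurable_Scell f g c c'.
have := D _ _ _ _ (D _ _ _ _ (D _ _ _ _ (Z (k2 * l2) _ _ i11) (Z (k3 * l3) _ _ i22))
  (Z (k2 * l3 + k3 * l2) _ _ i12))
  (D _ _ _ _ (D _ _ _ _ (Z (k2 * b + a * l2) _ _ i1) (Z (k3 * b + a * l3) _ _ i2))
     (Z (a * b) _ _ i0)).
apply: (eq_has_integral measurable_Scell); last by ring.
by move=> x _; rewrite /axial; ring.
Qed.

Lemma half_plane_axial_integral n1 n2 l2 l3 b : n1 ^+ 2 + n2 ^+ 2 = 1 ->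
  has_integral leb2 Scell (fun x => \1_(half_plane n1 n2) x * axial l2 l3 b x)
   (2 / 3 * (l2 * n1 + l3 * n2) + b * (A / 2)).
Proof.
move=> n12.
have I (q : R * R -> R) : continuous q -> has_integral leb2 Scell _ _ :=
  fun cq => has_integral_integral (half_plane_mul_integrable n1 n2 cq).
have i1 : has_integral leb2 (@Scell R) (fun x => \1_(half_plane n1 n2) x * x.1) (2 / 3 * n1).
  by rewrite -(half_disc_moment1 n12); apply: I; apply: cont; constructor.
have i2 : has_integral leb2 (@Scell R) (fun x => \1_(half_plane n1 n2) x * x.2) (2 / 3 * n2).
  by rewrite -(half_disc_moment2 n12); apply: I; apply: cont; constructor.
have i0 : has_integral leb2 (@Scell R) (fun x => \1_(half_plane n1 n2) x * 1) (A / 2).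
  rewrite -(half_disc_area n12).
  have -> : \int[leb2]_(x in Scell) \1_(half_plane n1 n2) x =
      \int[leb2]_(x in Scell) (\1_(half_plane n1 n2) x * 1) :> R.
    by apply: eq_Rintegral => x _; rewrite mulr1.
  by apply: I; apply: cont; constructor.
have := has_integralD measurable_Scell (has_integralD measurable_Scell
  (has_integralZ measurable_Scell l2 i1) (has_integralZ measurable_Scell l3 i2))
  (has_integralZ measurable_Scell b i0).
apply: (eq_has_integral measurable_Scell); last by ring.
by move=> x _; rewrite /axial; ring.
Qed.

End Moments.

(** * The half-open sector in rotated coordinates *)

Section Sector.
Context {R : realType}.
Local Notation mR := (measurableTypeR R).
Local Notation mRR := (mR * mR)%type.
Variables alpha theta : R.
Local Notation n1 := (cos alpha).
Local Notation n2 := (sin alpha).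

(* The sector of [Zset] is half open, hence the lower half of its diameter. *)
Definition half_disc : set mRR :=
  half_plane n1 n2 `|` (line n1 n2 `&` [set x | - n2 * x.1 + n1 * x.2 <= 0]).

Lemma measurable_half_disc : measurable half_disc.
Proof.
apply: measurableU; first exact: measurable_half_plane.
apply: measurableI; first exact: measurable_line.
have := @measurable_continuous_prod _ (fun x => - n2 * x.1 + n1 * x.2) setT.
move=> /(_ _ measurableT `]-oo, 0]%classic (measurable_itv _)); rewrite setTI.
rewrite (_ : _ @^-1` _ = [set x : mRR | - n2 * x.1 + n1 * x.2 <= 0]).
  by apply; apply: elementary_continuous; repeat constructor.
by apply/seteqP; split => x /=; rewrite in_itv.
Qed.

(** Relative to the axis the angle runs over the half-open interval from -pi/2 to pi/2: the cosine
    is positive except at the closed end, which accounts for the lower half of the diameter. *)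
Lemma ZsetE (z : (R * R) * R) : SY z ->
  Zset theta alpha z <-> z.2 < theta /\ half_disc z.1.
Proof.
move=> Sz; have [/= Sx] := Sz; rewrite /Ycell/= in_itv/= => /andP[y0 y1].
have n12 := cos2Dsin2 alpha.
split.
  move=> [_ /andP[_ yt] [r [phi [/andP[r0 r1] /andP[phi1 phi2] zE]]]].
  split => //; rewrite zE.
  have E1 : n1 * (r * cos phi) + n2 * (r * sin phi) = r * cos (phi - alpha).
    by rewrite cosB; ring.
  have E2 : - n2 * (r * cos phi) + n1 * (r * sin phi) = r * sin (phi - alpha).
    by rewrite sinB; ring.
  have [phiE|phiE] := eqVneq (phi - alpha) (- (pi / 2)).
    right; split; rewrite /line/= ?E1 ?E2 phiE ?cosN ?sinN ?cos_pihalf ?sin_pihalf.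
      by rewrite mulr0.
    by rewrite mulrN1 oppr_le0.
  have c0 : 0 < cos (phi - alpha).
    apply: cos_gt0_pihalf; apply/andP; split; last by lra.
    by rewrite lt_neqAle eq_sym phiE/=; lra.
  (* The radius 0 gives the origin, which [half_disc] counts with the diameter. *)
  move: r0; rewrite le_eqVlt => /predU1P[<-|r0].
    by right; split; rewrite /line/= !mul0r !mulr0 addr0.
  by left; rewrite /half_plane/= E1 mulr_gt0.
(* Conversely, [u] and [w] are the coordinates of the point along the axis and across it. *)
move=> [yt Hx]; split => //; first by rewrite y0 yt.
pose u := n1 * z.1.1 + n2 * z.1.2; pose w := - n2 * z.1.1 + n1 * z.1.2.
have uw : u ^+ 2 + w ^+ 2 = z.1.1 ^+ 2 + z.1.2 ^+ 2.
  transitivity ((n1 ^+ 2 + n2 ^+ 2) * (z.1.1 ^+ 2 + z.1.2 ^+ 2)).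
    by rewrite /u /w; ring.
  by rewrite n12 mul1r.
have uw1 : u ^+ 2 + w ^+ 2 < 1 by rewrite uw.
have x1E : z.1.1 = u * n1 - w * n2.
  transitivity ((n1 ^+ 2 + n2 ^+ 2) * z.1.1); first by rewrite n12 mul1r.
  by rewrite /u /w; ring.
have x2E : z.1.2 = u * n2 + w * n1.
  transitivity ((n1 ^+ 2 + n2 ^+ 2) * z.1.2); first by rewrite n12 mul1r.
  by rewrite /u /w; ring.
case: Hx => [u0|[u0 w0]]; last first.
  (* On the diameter u = 0 and w <= 0, so the point sits at the closed end of the angular range, at
     distance - w from the origin. *)
  exists (- w), (alpha - pi / 2); split.
  - by rewrite /line/= -/u in u0; rewrite /= -/w in w0; apply/andP; split; nra.
  - by rewrite lexx /=; have := pi_gt0 R; lra.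
  - rewrite /line/= -/u in u0.
    rewrite [z.1]surjective_pairing x1E x2E u0 cosB sinB cos_pihalf sin_pihalf.
    by congr pair; ring.
rewrite /half_plane/= -/u in u0.
pose r := Num.sqrt (u ^+ 2 + w ^+ 2).
have r2 : r ^+ 2 = u ^+ 2 + w ^+ 2 by rewrite sqr_sqrtr// addr_ge0 ?sqr_ge0.
have r0 : 0 < r by rewrite sqrtr_gt0 ltr_pwDl ?sqr_ge0 ?exprn_gt0.
have r_neq0 : r != 0 by rewrite gt_eqF.
have wr : -1 < w / r < 1.
  rewrite ltr_pdivlMr// ltr_pdivrMr// mulN1r mul1r.
  by rewrite -ltr_norml -(ltr_pXn2r (n := 2)) ?nnegrE ?(ltW r0)// real_normK ?num_real// r2 ltrDr exprn_gt0.
have /andP[wr1 wr2] := wr.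
have wr' : -1 <= w / r <= 1 by rewrite !ltW.
(* In the open half plane the angle from the axis has sine w / r and positive cosine u / r, so it is
   the arcsine. *)
exists r, (alpha + asin (w / r)).
have sE : sin (asin (w / r)) = w / r by rewrite asinK// in_itv/=.
have cE : cos (asin (w / r)) = u / r.
  rewrite cos_asin//; have -> : 1 - (w / r) ^+ 2 = (u / r) ^+ 2.
    by rewrite !expr_div_n r2; field; rewrite -r2 expf_neq0.
  by rewrite sqrtr_sqr ger0_norm// divr_ge0// ltW.
split.
- rewrite (ltW r0)/=; apply: ltW.
  by rewrite -(ltr_pXn2r (n := 2)) ?nnegrE ?(ltW r0)// r2 expr1n.
- apply/andP; split.
    by rewrite lerD2l asin_geNpi2.
  by rewrite ltrD2l asin_ltpi2// (ltW wr1).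
- rewrite [z.1]surjective_pairing x1E x2E cosD sinD sE cE.
  by congr pair; field.
Qed.

End Sector.

(** * Pairing of the sector prestrain with affine functions *)

Section SectorIntegral.
Context {R : realType}.
Local Notation mR := (measurableTypeR R).
Local Notation mRR := (mR * mR)%type.
Variables (theta alpha : R).
Hypothesis theta01 : 0 <= theta <= 1.
Local Notation n1 := (cos alpha).
Local Notation n2 := (sin alpha).
Local Notation c := (3 * pi / 8 : R).
Local Notation A := (@disc_area R).

Lemma indic_ZsetE (z : (R * R) * R) : SY z -> \1_(Zset theta alpha) z =
  \1_(`]-oo, theta[%classic : set mR) z.2 * \1_(half_disc alpha) z.1 :> R.
Proof.
move=> Sz; have [ZH HZ] := ZsetE alpha theta Sz.
rewrite !indicE; have [/set_mem Zz|nZ] := boolP (z \in Zset _ _).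
  have [yt Hx] := ZH Zz; rewrite !mem_set ?mulr1//=.
have [/set_mem yt|_] := boolP (z.2 \in _); last by rewrite mul0r.
have [/set_mem Hx|_] := boolP (z.1 \in _); last by rewrite mulr0.
by case/negP: nZ; apply/mem_set/HZ; split => //; move: yt; rewrite /= in_itv.
Qed.

Lemma measurable_indic_Zset :
  measurable_fun (SY : set (mRR * mR)) (\1_(Zset theta alpha) : mRR * mR -> R).
Proof.
have mf : measurable_fun (SY : set (mRR * mR)) (fun z : mRR * mR =>
    \1_(`]-oo, theta[%classic : set mR) z.2 * \1_(half_disc alpha) z.1 : R).
  apply: measurable_funM.
    by apply: (@measurable_SY_snd _ (\1_(`]-oo, theta[%classic : set mR))); exact: measurable_indic.
  apply: (@measurable_SY_fst _ (\1_(half_disc alpha))).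
  by apply: measurable_indic; exact: measurable_half_disc.
by apply: eq_measurable_fun mf => z; rewrite inE => Sz; rewrite indic_ZsetE.
Qed.

Lemma L2_sector : L2 leb3 SY (fun z => c * \1_(Zset theta alpha) z).
Proof.
apply: (L2Z measurable_SY).
apply: (@L2_bounded _ _ _ _ _ measurable_SY leb3_SY_fin _ 1).
  exact: measurable_indic_Zset.
by move=> z _; rewrite indicE; case: (_ \in _); rewrite ?normr1 ?normr0.
Qed.

(** The half-open sector and the open half plane differ by part of a line, which is null. *)
Lemma half_disc_axial_integral l2 l3 b : has_integral leb2 Scell
  (fun x => \1_(half_disc alpha) x * axial l2 l3 b x)
  (2 / 3 * (l2 * n1 + l3 * n2) + b * (A / 2)).
Proof.
have n12 := cos2Dsin2 alpha.
have := half_plane_axial_integral l2 l3 b n12.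
have L0 : {ae leb2, forall x, Scell x -> \1_(line n1 n2) x = 0 :> R}.
  apply: (has_integral_ge0_eq0 measurable_Scell).
    by move=> x _; rewrite indicE ler0n.
  by split; [exact: line_integrable|exact: line_integral].
apply: (has_integral_ae measurable_Scell).
  apply: measurable_funM; last first.
    by apply: measurable_continuous_prod; exact: continuous_axial.
  by apply: measurable_indic; exact: measurable_half_disc.
apply: filterS L0 => x h Sx; congr (_ * _).
rewrite !indicE; congr (_%:R); congr nat_of_bool; apply/idP/idP; rewrite !inE.
  by left.
move=> [//|[xL _]]; have := h Sx; rewrite indicE mem_set// => /eqP.
by rewrite oner_eq0.
Qed.

Lemma has_integral_indic_Ycell :
  has_integral leb1 Ycell (\1_(`]-oo, theta[%classic : set mR)) theta.
Proof.
have /andP[t0 t1] := theta01.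
split.
  apply: (@integrable_bounded _ _ _ _ _ measurable_Ycell leb1_Ycell_fin _ 1).
    exact: measurable_indic.
  by move=> y _; rewrite indicE; case: (_ \in _); rewrite ?normr1 ?normr0.
rewrite /Rintegral integral_indic//; last exact: measurable_Ycell.
have -> : `]-oo, theta[%classic `&` Ycell = `[0, theta[%classic :> set R.
  apply/seteqP; split => y /=; rewrite /Ycell/= !in_itv/=.
    by move=> [-> /andP[-> _]].
  by move=> /andP[-> yt]; rewrite yt; split => //; rewrite (lt_le_trans yt).
transitivity (fine (@lebesgue_measure R `[0, theta[%classic)); first by [].
rewrite lebesgue_measure_itv/= lte_fin; case: ifPn => [_|]; first by rewrite sube0.
by rewrite -leNgt => t0'; apply: le_anti; rewrite /= t0 t0'.
Qed.

(** The factor 3 pi / 8 is tuned so that its product with 2 / 3, from the first moment of the half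
    disc, is the second moment pi / 4 of the disc. The bending term thus vanishes for all l2, l3
    exactly when (k2, k3) is theta times the axis, and the stretching term vanishes when [a] is the
    mean c theta / 2 of the prestrain. *)
Lemma sector_integral k2 k3 a l2 l3 b : has_integral leb3 SY (fun z =>
    axial l2 l3 b z.1 * (c * \1_(Zset theta alpha) z - axial k2 k3 a z.1))
  (pi / 4 * (l2 * (theta * n1 - k2) + l3 * (theta * n2 - k3)) +
   b * A * (c * theta / 2 - a)).
Proof.
have L : L2 leb3 SY (fun z => c * \1_(Zset theta alpha) z - axial k2 k3 a z.1).
  apply: (L2B measurable_SY L2_sector).
  exact/continuous_SY_L2/continuous_axial.
have fi := L2_integrable measurable_SY leb3_SY_fin
  (L2_mul_continuous_SY L (continuous_axial (k2 := l2) (k3 := l3) (a := b))).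
pose g y := \1_(`]-oo, theta[%classic : set mR) y *
  (c * (2 / 3 * (l2 * n1 + l3 * n2) + b * (A / 2))) -
  (pi / 4 * (k2 * l2 + k3 * l3) + a * b * A).
have c1 : has_integral leb1 (@Ycell R) (fun=> 1) 1.
  split; last first.
    rewrite Rintegral_cst; last exact: measurable_Ycell.
    by rewrite [X in fine X](leb1_Ycell (R := R)) mul1r.
  apply: (@integrable_bounded _ _ _ _ _ measurable_Ycell leb1_Ycell_fin _ 1) => //.
  by move=> y _; rewrite normr1.
have gI : has_integral leb1 Ycell g (theta * (c * (2 / 3 * (l2 * n1 + l3 * n2) + b * (A / 2))) -
   (pi / 4 * (k2 * l2 + k3 * l3) + a * b * A)).
  have := has_integralB measurable_Ycell (has_integralZ measurable_Ycell
    (c * (2 / 3 * (l2 * n1 + l3 * n2) + b * (A / 2))) has_integral_indic_Ycell)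
    (has_integralZ measurable_Ycell (pi / 4 * (k2 * l2 + k3 * l3) + a * b * A) c1).
  apply: (eq_has_integral measurable_Ycell); last by ring.
  by move=> y _; rewrite /g; ring.
have mg := has_integral_measurable gI.
have -> : pi / 4 * (l2 * (theta * n1 - k2) + l3 * (theta * n2 - k3)) +
   b * A * (c * theta / 2 - a) = \int[leb1]_(y in Ycell) g y.
  by have [_ ->] := gI; field.
apply: SY_fubini2 => //.
apply: aeW => y Yy.
have := has_integralB measurable_Scell
  (has_integralZ measurable_Scell (c * \1_(`]-oo, theta[%classic : set mR) y) (half_disc_axial_integral l2 l3 b))
  (disc_axial_integral k2 k3 a l2 l3 b).
move=> [_ H]; rewrite /g [_ * (c * _)]mulrCA mulrA -H.
apply: eq_Rintegral => x; rewrite inE => Sx.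
by rewrite indic_ZsetE//=; ring.
Qed.

End SectorIntegral.

(** * Choice of the prestrain *)

Section PolarAngle.
Context {R : realType}.
Local Notation mR := (measurableTypeR R).

Definition modulus (k2 k3 : R) : R := Num.sqrt (k2 ^+ 2 + k3 ^+ 2).

(* At the origin [u = 0], and the angle is [pi / 2]. *)
Definition polar_angle (k2 k3 : R) : R :=
  let u := k2 / modulus k2 k3 in
  if `|u| < 1 then (if 0 <= k3 then acos u else 2 * pi - acos u)
  else if 0 <= u then 0 else pi.

Lemma polar_angle_range k2 k3 : 0 <= polar_angle k2 k3 < 2 * pi.
Proof.
have p := pi_gt0 R; rewrite /polar_angle; set u := k2 / _.
case: ifPn => [|_]; last by case: ifP => _; apply/andP; lra.
rewrite ltr_norml => /andP[u1 u2].
have H0 : 0 < acos u by rewrite acos_gt0// (ltW u1).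
have H1 : acos u < pi by rewrite acos_ltpi// u1 ltW.
by case: ifP => _; apply/andP; lra.
Qed.

(** The sine of [acos u] is |k3| divided by the modulus; passing to 2 pi - acos u when k3 < 0
    restores the sign without changing the cosine. *)
Lemma polar_angleE k2 k3 :
  modulus k2 k3 * cos (polar_angle k2 k3) = k2 /\
  modulus k2 k3 * sin (polar_angle k2 k3) = k3.
Proof.
have r2 : modulus k2 k3 ^+ 2 = k2 ^+ 2 + k3 ^+ 2.
  by rewrite sqr_sqrtr// addr_ge0 ?sqr_ge0.
have [r0|r_neq0] := eqVneq (modulus k2 k3) 0.
  rewrite r0 !mul0r; move: r2; rewrite r0 expr0n/= => /esym/eqP.
  rewrite paddr_eq0 ?sqr_ge0// !sqrf_eq0 => /andP[/eqP-> /eqP->].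
  by [].
have r_gt0 : 0 < modulus k2 k3 by rewrite lt0r r_neq0 sqrtr_ge0.
rewrite /polar_angle; set r := modulus k2 k3 in r2 r_neq0 r_gt0 *.
set u := k2 / r; pose v := k3 / r.
have k2E : k2 = r * u by rewrite /u mulrC divfK.
have k3E : k3 = r * v by rewrite /v mulrC divfK.
have uv : u ^+ 2 + v ^+ 2 = 1.
  by apply: (mulfI (expf_neq0 2 r_neq0)); rewrite mulr1 mulrDr -!exprMn -k2E -k3E.
suff [-> ->] : cos (if `|u| < 1 then (if 0 <= k3 then acos u else 2 * pi - acos u)
    else if 0 <= u then 0 else pi) = u /\
  sin (if `|u| < 1 then (if 0 <= k3 then acos u else 2 * pi - acos u)
    else if 0 <= u then 0 else pi) = v by rewrite -k2E -k3E.
have v0 : (0 <= k3) = (0 <= v) by rewrite /v pmulr_lge0// invr_gt0.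
case: ifPn => [|]; last first.
  rewrite -leNgt -(ler_pXn2r (n := 2)) ?nnegrE// expr1n real_normK ?num_real// => u1.
  have v0' : v = 0 by apply/eqP; rewrite -sqrf_eq0 eq_le sqr_ge0 andbT; lra.
  have u2 : u ^+ 2 = 1 by rewrite -uv v0' expr0n addr0.
  rewrite v0'; case: ifPn => [u0|]; [rewrite cos0 sin0|rewrite cospi sinpi -ltNge => u0].
    by split=> //; apply/eqP; rewrite eq_sym -sqrp_eq1 // u2.
  by split=> //; apply/eqP; rewrite eqr_oppLR eq_sym -sqrp_eq1 ?sqrrN ?u2// oppr_ge0 ltW.
rewrite ltr_norml => /andP[u1 u2].
have u12 : -1 <= u <= 1 by rewrite !ltW.
have sE : sin (acos u) = `|v|.
  by rewrite sin_acos// -uv addrC addKr sqrtr_sqr.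
case: ifPn => k30.
  by rewrite acosK ?in_itv//= sE ger0_norm// -v0.
rewrite cosB sinB mulr_natl cos2pi sin2pi sE acosK ?in_itv//=.
rewrite ler0_norm; last by rewrite leNgt; apply: contra k30 => /ltW; rewrite v0.
by split; ring.
Qed.

Lemma measurable_modulus d (T : measurableType d) (D : set T) (k2 k3 : T -> R) :
  measurable_fun D k2 -> measurable_fun D k3 ->
  measurable_fun D (fun x => modulus (k2 x) (k3 x)).
Proof.
move=> m2 m3; apply: (@measurableT_comp _ _ _ _ _ _ (@Num.sqrt R)).
  by apply: continuous_measurable_fun; exact: sqrt_continuous.
by apply: measurable_funD; exact: measurable_funX.
Qed.

(** The split on |u| < 1 in [polar_angle] pays off here: [acos] is applied only on the open
    interval, where its continuity gives measurability, and the remaining values are constants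
    selected by a measurable test. *)
Lemma measurable_polar_angle d (T : measurableType d) (D : set T) (k2 k3 : T -> R) :
  measurable D -> measurable_fun D k2 -> measurable_fun D k3 ->
  measurable_fun D (fun x => polar_angle (k2 x) (k3 x)).
Proof.
move=> mD m2 m3; have mr := measurable_modulus m2 m3.
have mV : measurable_fun (setT : set mR) (fun x : R => x^-1).
  rewrite -(setUv [set 0]); apply/measurable_funU => //.
    exact: measurableC.
  split; first exact: measurable_fun_set1.
  apply: open_continuous_measurable_fun; first exact/closed_openC/closed_eq.
  by move=> x; rewrite inE/= => /eqP x0; exact: inv_continuous.
have mu : measurable_fun D (fun x => k2 x / modulus (k2 x) (k3 x)).
  by apply: measurable_funM => //; exact: (measurableT_comp mV).
have macos : measurable_fun (`]-1, 1[%classic : set mR) (@acos R).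
  apply: open_continuous_measurable_fun; first exact: interval_open.
  by move=> x; rewrite inE/= in_itv/= => /continuous_acos.
have b1 : measurable_fun D (fun x => `|k2 x / modulus (k2 x) (k3 x)| < 1).
  by apply: measurable_fun_ltr => //; exact: measurableT_comp.
apply: measurable_fun_if => //.
- have mD' : measurable (D `&` (fun x => `|k2 x / modulus (k2 x) (k3 x)| < 1) @^-1` [set true]).
    exact: b1.
  have ma : measurable_fun (D `&` (fun x => `|k2 x / modulus (k2 x) (k3 x)| < 1) @^-1` [set true])
      (fun x => acos (k2 x / modulus (k2 x) (k3 x))).
    apply: (measurable_comp (F := `]-1, 1[%classic : set mR)) macos _.
    + exact: measurable_itv.
    + by move=> _ [x [_ /= h] <-]; rewrite in_itv/= -ltr_norml.
    + by apply: measurable_funS mu => // x [].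
  apply: measurable_fun_if => //.
  + by apply: measurable_fun_ler => //; apply: measurable_funS m3 => // x [].
  + by apply: measurable_funS ma => // x [].
  + by apply: measurable_funB => //; apply: measurable_funS ma => // x [].
- apply: measurable_fun_if => //.
  + exact: b1.
  + by apply: measurable_fun_ler => //; apply: measurable_funS mu => // x [].
Qed.

End PolarAngle.

Section BendingMatrix.
Context {R : realType}.

Definition bending_mx (k2 k3 : R) : 'M[R]_3 := \matrix_(i, j)
  (if i == 0 then (if j == 1 then k2 else if j == 2%:R then k3 else 0)
   else if j == 0 then (if i == 1 then - k2 else - k3) else 0).

Lemma skew3_bending_mx k2 k3 : skew3 (bending_mx k2 k3).
Proof.
apply/matrixP => i j; rewrite !mxE.
by have [->|->|->] := ord3P i; have [->|->|->] := ord3P j; rewrite /= ?oppr0 ?opprK.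
Qed.

Lemma leb1_omega_fin (ell : R) : ((@leb1 R) (omega ell) < +oo)%E.
Proof.
rewrite /leb1 /omega lebesgue_measure_itv/=.
by case: ifP => _; rewrite -?EFinD ltry.
Qed.

Lemma L2_skew_bending_mx (ell : R) (k2 k3 : R -> R) (c : R) :
  measurable_fun (omega ell : set (measurableTypeR R)) k2 ->
  measurable_fun (omega ell : set (measurableTypeR R)) k3 ->
  (forall x, omega ell x -> `|k2 x| <= c /\ `|k3 x| <= c) ->
  L2_skew ell (fun x => bending_mx (k2 x) (k3 x)).
Proof.
move=> m2 m3 kc; split; last by apply: aeW => x _; exact: skew3_bending_mx.
have mO : measurable (omega ell : set (measurableTypeR R)) by exact: measurable_itv.
have fO := leb1_omega_fin ell.
have L (k : R -> R) : measurable_fun (omega ell : set (measurableTypeR R)) k ->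
    (forall x, omega ell x -> `|k x| <= c) -> L2 leb1 (omega ell) k.
  by move=> mk; exact: (L2_bounded mO fO).
have L_2 := L _ m2 (fun x h => (kc x h).1); have L_3 := L _ m3 (fun x h => (kc x h).2).
have N (k : R -> R) : L2 leb1 (omega ell) k -> L2 leb1 (omega ell) (fun x => - k x).
  by move=> /(L2Z mO (-1)); under eq_fun do rewrite mulN1r.
have Z : L2 leb1 (omega ell) (fun=> 0).
  by apply: (L2_bounded mO fO (c := 0)) => // x _; rewrite normr0.
move=> i j; under eq_fun do rewrite mxE.
have [->|->|->] := ord3P i; have [->|->|->] := ord3P j => //=; exact: N.
Qed.

End BendingMatrix.

Theorem lemma4p2 (R : realType) (mu lambda ell : R) (gamma : regime)
    (mu_gt0 : 0 < mu) (lambda_ge0 : 0 <= lambda) (ell_gt0 : 0 < ell)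
    (K : R -> 'M[R]_3)
    (K_L2 : L2_skew ell K)
    (K_le1 : {ae leb1, forall x1, omega ell x1 ->
                fnorm (K x1 *m e_ 0) <= 1}) :
  exists alpha theta : R -> R,
    [/\ measurable_fun (omega ell) alpha,
        measurable_fun (omega ell) theta,
        forall x1, omega ell x1 -> 0 <= alpha x1 < 2 * pi,
        forall x1, omega ell x1 -> 0 <= theta x1 <= 1 &
        (exists (Keff : R -> 'M[R]_3) (aeff : R -> R),
           is_eff mu lambda ell gamma (prestrain theta alpha) Keff aeff) /\
        (forall (Keff : R -> 'M[R]_3) (aeff : R -> R),
           is_eff mu lambda ell gamma (prestrain theta alpha) Keff aeff ->
           {ae leb1, forall x1, omega ell x1 ->
              (K x1 - Keff x1) *m e_ 0 = 0})].
Proof.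
have [LK sK] := K_L2.
pose k2 x := K x 0 1; pose k3 x := K x 0 2%:R.
have m2 : measurable_fun (omega ell : set (measurableTypeR R)) k2 by case: (LK 0 1).
have m3 : measurable_fun (omega ell : set (measurableTypeR R)) k3 by case: (LK 0 2%:R).
pose alpha x := polar_angle (k2 x) (k3 x).
(* The bound on K e_1 holds only almost everywhere; truncating at 1 puts theta in [0, 1] at every
   point and changes it on a null set of omega only. *)
pose theta x := Num.min 1 (modulus (k2 x) (k3 x)).
have mO : measurable (omega ell : set (measurableTypeR R)) by exact: measurable_itv.
have malpha : measurable_fun (omega ell : set (measurableTypeR R)) alpha.
  exact: (measurable_polar_angle mO m2 m3).
have mtheta : measurable_fun (omega ell : set (measurableTypeR R)) theta.
  by apply: measurable_minr => //; exact: (measurable_modulus m2 m3).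
have theta01 x : 0 <= theta x <= 1.
  by rewrite /theta le_min ler01 sqrtr_ge0/= ge_min lexx.
exists alpha, theta; split => //; first by move=> x _; exact: polar_angle_range.
split.
(* Existence of (K_eff, a_eff), without which the second claim could hold vacuously. The witnesses
   are the zeros of the value in [sector_integral], with torsion 0. *)
- pose k2' x := theta x * cos (alpha x); pose k3' x := theta x * sin (alpha x).
  pose a' x := 3 * pi / 8 * theta x / 2.
  exists (fun x => bending_mx (k2' x) (k3' x)), a'.
  have mc (f : R -> R) : continuous f -> measurable_fun (omega ell : set (measurableTypeR R))
      (fun x => theta x * f (alpha x)).
    move=> cf; apply: measurable_funM => //.
    by apply: (measurableT_comp (f := f)) => //; exact: continuous_measurable_fun.
  split.
  + apply: (@L2_skew_bending_mx _ _ _ _ 1).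
    * exact: (mc (@cos R) (@continuous_cos R)).
    * exact: (mc (@sin R) (@continuous_sin R)).
    * move=> x _; have /andP[t0 t1] := theta01 x.
      by rewrite !normrM (ger0_norm t0); split; rewrite mulr_ile1//;
        rewrite ler_norml ?cos_geN1 ?cos_le1 ?sin_geN1 ?sin_le1.
  + apply: (L2_bounded mO (leb1_omega_fin ell) (c := 3 * pi / 8 * 1 / 2)).
      by apply: measurable_funM => //; exact: measurable_funM.
    move=> x _; have /andP[t0 t1] := theta01 x; have p := pi_gt0 R.
    rewrite ger0_norm /a'; last by rewrite !mulr_ge0 ?invr_ge0// ltW.
    by rewrite ler_pM2r ?invr_gt0// ler_pM2l// !mulr_gt0// invr_gt0.
  + apply: aeW => x _.
    exists (relaxed mu lambda (bending_mx (k2' x) (k3' x)) (a' x)); split.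
      by apply: is_Prel_EE => //; exact: skew3_bending_mx.
    apply: (is_Prel_scalar mu_gt0 lambda_ge0 (L2_sector (theta x) (alpha x))).
    * exact: skew3_bending_mx.
    * by rewrite mxE.
    * move=> K' b sK'; rewrite !mxE/=.
      have := @sector_integral _ (theta x) (alpha x) (theta01 x) (k2' x) (k3' x) (a' x)
        (K' 0 1) (K' 0 2%:R) b.
      by rewrite /k2' /k3' /a' !subrr !mulr0 !addr0 mulr0.
- move=> Keff aeff [[_ sKeff] _ Heff].
  apply: filterS3 sKeff Heff (filterI sK K_le1) => x sKe He [sKx Kx] xO.
  have {}sKe := sKe xO; have {}sKx := sKx xO; have {}Kx := Kx xO.
  have [P [PE PB]] := He xO.
  (* By skew symmetry the first column of K is minus its first row, so both have the same norm. The
     pointwise bound then makes the truncation in theta inactive. *)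
  have modE : modulus (k2 x) (k3 x) = fnorm (K x *m e_ 0).
    rewrite /modulus /fnorm /e_ -colE; congr Num.sqrt.
    rewrite sum_ord3 !big_ord1 !mxE (skew3_diag 0 sKx) (skew3E 1 0 sKx) (skew3E 2%:R 0 sKx).
    by rewrite /k2 /k3; ring.
  have thetaE : theta x = modulus (k2 x) (k3 x) by rewrite /theta min_r// modE.
  have [k2E k3E] := polar_angleE (k2 x) (k3 x).
  (* Testing with stretch 0 removes a_eff and the area, and polar coordinates turn theta times the
     axis into (k2, k3). Since l2 and l3 are free, the two unit choices determine the bending
     entries of K_eff. *)
  have orth l2 l3 : pi / 4 * (l2 * (k2 x - Keff x 0 1) + l3 * (k3 x - Keff x 0 2%:R)) = 0.
    have sl := skew3_bending_mx l2 l3.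
    have l12 : bending_mx l2 l3 1 2%:R = 0 by rewrite mxE.
    have := is_Prel_scalar_orth mu_gt0 lambda_ge0 (L2_sector (theta x) (alpha x)) sKe PE PB 0 sl l12.
    have := @sector_integral _ (theta x) (alpha x) (theta01 x) (Keff x 0 1) (Keff x 0 2%:R) (aeff x)
        (bending_mx l2 l3 0 1) (bending_mx l2 l3 0 2%:R) 0.
    move=> h1 h2; have := has_integral_uniq h1 h2.
    by rewrite !mxE/= thetaE k2E k3E !mul0r addr0.
  have pi4 : pi / 4 != 0 :> R by rewrite mulf_neq0 ?invr_neq0// gt_eqF// pi_gt0.
  have e2 : k2 x = Keff x 0 1.
    have /eqP := orth 1 0; rewrite mulf_eq0 (negbTE pi4)/= mul1r mul0r addr0 subr_eq0.
    by move/eqP.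
  have e3 : k3 x = Keff x 0 2%:R.
    have /eqP := orth 0 1; rewrite mulf_eq0 (negbTE pi4)/= mul1r mul0r add0r subr_eq0.
    by move/eqP.
  rewrite /e_ -colE; apply/matrixP => i j; rewrite !mxE.
  have [->|->|->] := ord3P i.
  + by rewrite (skew3_diag 0 sKx) (skew3_diag 0 sKe) subrr.
  + by rewrite (skew3E 1 0 sKx) (skew3E 1 0 sKe) -e2 subrr.
  + by rewrite (skew3E 2%:R 0 sKx) (skew3E 2%:R 0 sKe) -e3 subrr.
Qed.
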